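(* Let ND be a class of network design problems in the sense described in the context. If there exists a deterministic (respectively randomized) polynomial-time $\gamma$-approximation algorithm for the offline problem ND, then there exists an $O(\gamma\log(\min\{k,|\mathcal{E}|\}))$-competitive deterministic (respectively randomized) online algorithm for ND with deadlines, which runs in polynomial time. Here $k$ is the number of requests in the input and $\mathcal{E}$ is the set of elements.
   Context: An instance of an (abstract) network design problem consists of a finite set $\mathcal{E}$ of elements with costs $c:\mathcal{E}\to\mathbb{R}^+$; each request $q$ is associated with an upward-closed family $X_q\subseteq 2^{\mathcal{E}}$; a set $E$ satisfies $q$ if $E\in X_q$. The offline problem: given requests $Q$, find a minimum-cost $E\subseteq\mathcal{E}$ satisfying all of them. ND denotes a class of such problems. A $\gamma$-approximation algorithm returns a feasible solution of cost at most $\gamma$ times optimal; for randomized algorithms the approximation guarantee is deterministic and the running-time bound holds in expectation. ND with deadlines: elements and costs known in advance; request $q$ released at time $r_q$ with deadline $d_q$ revealed at release ($k$, the total number of requests, is not known in advance); at any time the algorithm may transmit $E\subseteq\mathcal{E}$ at cost $\sum_{e\in E}c(e)$, serving every pending request $q$ with $E\in X_q$; each request must be served within $[r_q,d_q]$; the cost is the total transmission cost. An algorithm is $\alpha$-competitive if its (expected) cost is always at most $\alpha$ times the optimal offline cost. *)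

(* Defs.v *)
From HB Require Import structures.
From mathcomp Require Import all_boot all_order all_algebra.
From mathcomp Require Import all_classical all_reals all_analysis.

Set Implicit Arguments.
Unset Strict Implicit.
Unset Printing Implicit Defensive.

Import Order.TTheory GRing.Theory Num.Theory.
Local Open Scope classical_set_scope.
Local Open Scope ring_scope.

(** * Network design problems *)

(** One ground structure.  [nd_desc] and [nd_code] are what an algorithm gets to
    see of the structure (e.g. the graph) and of a request; they need not be
    injective.  Data are binary trees whose leaves are real numbers, so real
    costs and times can be input exactly. *)
Inductive data (K : Type) : Type :=
| Null
| Num of K
| Pair of data K & data K.
Arguments Null {K}.
Arguments Num {K} _.
Arguments Pair {K} _ _.

Record network (R : realType) := Network {
  elt : finType;
  cost : elt -> R;
  cost_ge0 : forall e, 0 <= cost e;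
  request : Type;
  sat : request -> {set {set elt}};
  sat_up : forall q (E E' : {set elt}),
    E \in sat q -> E \subset E' -> E' \in sat q;
  nd_desc : data R;
  nd_code : request -> data R
}.

Section Problems.
Variables (R : realType) (I : network R).

Definition set_cost (E : {set elt I}) : R := \sum_(e in E) cost e.

Definition feasible (Q : seq (request I)) (E : {set elt I}) : bool :=
  all (fun q => E \in sat q) Q.

Definition opt (Q : seq (request I)) : R :=
  inf [set set_cost E | E in [set E | feasible Q E]].

Record timed_request := TimedRequest {
  treq : request I;
  release : R;
  deadline : R
}.

(** The requests of an online input are listed in order of arrival. *)
Definition online_input (s : seq timed_request) : bool :=
  sorted (fun q q' => release q <= release q') s &&
  all (fun q => release q <= deadline q) s.

Definition schedule := seq (R * {set elt I}).

Definition sched_cost (S : schedule) : R := \sum_(x <- S) set_cost x.2.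

Definition sched_feasible (s : seq timed_request) (S : schedule) : bool :=
  all (fun q => has (fun x => (release q <= x.1 <= deadline q) &&
                              (x.2 \in sat (treq q))) S) s.

Definition opt_deadlines (s : seq timed_request) : R :=
  inf [set sched_cost S | S in [set S | sched_feasible s S]].

End Problems.

(** * Model of computation

    A real-number machine in the style of Blum, Shub and Smale: arithmetic and
    comparison on real leaves, construction and destruction of pairs and fair
    coin flips take unit time.  Programs are finite (their only numeric literals
    are natural numbers) and do not depend on the input.  There is no rounding
    operation and no deep equality test on trees. *)

Inductive expr : Type :=
| EVar of nat
| ENull
| ELit of nat
| EPair of expr & expr
| EFst of expr
| ESnd of expr
| EIsNum of expr
| EIsPair of expr
| EAdd of expr & expr
| ESub of expr & expr
| EMul of expr & expr
| EDiv of expr & expr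
| ELe of expr & expr.

Inductive cmd : Type :=
| Skip
| Assign of nat & expr
| Flip of nat
| Seq of cmd & cmd
| If of expr & cmd & cmd
| While of expr & cmd.

Fixpoint coin_free (c : cmd) : bool :=
  match c with
  | Skip | Assign _ _ => true
  | Flip _ => false
  | Seq c1 c2 | If _ c1 c2 => coin_free c1 && coin_free c2
  | While _ c1 => coin_free c1
  end.

Section Semantics.
Variable R : realType.
Local Notation data := (data R).

(** Every value other than [Null] counts as true. *)
Definition of_bool (b : bool) : data := if b then Num 1 else Null.

Definition truthy (d : data) : bool := if d is Null then false else true.

Definition arith (f : R -> R -> data) (d d' : data) : data :=
  if (d, d') is (Num x, Num y) then f x y else Null.

Definition store := nat -> data.

Definition upd (s : store) (x : nat) (d : data) : store :=
  fun y => if y == x then d else s y.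

Fixpoint eval (s : store) (e : expr) : data :=
  match e with
  | EVar x => s x
  | ENull => Null
  | ELit n => Num n%:R
  | EPair e1 e2 => Pair (eval s e1) (eval s e2)
  | EFst e1 => if eval s e1 is Pair d _ then d else Null
  | ESnd e1 => if eval s e1 is Pair _ d then d else Null
  | EIsNum e1 => of_bool (if eval s e1 is Num _ then true else false)
  | EIsPair e1 => of_bool (if eval s e1 is Pair _ _ then true else false)
  | EAdd e1 e2 => arith (fun x y => Num (x + y)) (eval s e1) (eval s e2)
  | ESub e1 e2 => arith (fun x y => Num (x - y)) (eval s e1) (eval s e2)
  | EMul e1 e2 => arith (fun x y => Num (x * y)) (eval s e1) (eval s e2)
  | EDiv e1 e2 => arith (fun x y => Num (x / y)) (eval s e1) (eval s e2)
  | ELe e1 e2 => arith (fun x y => of_bool (x <= y)) (eval s e1) (eval s e2)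
  end.

(** [exec c s w s' t]: started in [s], the command [c] halts in [s'] after [t]
    steps, having flipped exactly the coins [w], in this order.  The expressions
    of a program have bounded size, so each evaluation counts as one step. *)
Inductive exec : cmd -> store -> seq bool -> store -> nat -> Prop :=
| exec_skip s : exec Skip s [::] s 1
| exec_assign x e s : exec (Assign x e) s [::] (upd s x (eval s e)) 1
| exec_flip x b s : exec (Flip x) s [:: b] (upd s x (of_bool b)) 1
| exec_seq c1 c2 s w1 s1 t1 w2 s2 t2 :
    exec c1 s w1 s1 t1 -> exec c2 s1 w2 s2 t2 ->
    exec (Seq c1 c2) s (w1 ++ w2) s2 (t1 + t2)
| exec_if_true e c1 c2 s w s' t :
    truthy (eval s e) -> exec c1 s w s' t -> exec (If e c1 c2) s w s' t.+1
| exec_if_false e c1 c2 s w s' t :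
    ~~ truthy (eval s e) -> exec c2 s w s' t -> exec (If e c1 c2) s w s' t.+1
| exec_while_false e c s :
    ~~ truthy (eval s e) -> exec (While e c) s [::] s 1
| exec_while_true e c s w1 s1 t1 w2 s2 t2 :
    truthy (eval s e) -> exec c s w1 s1 t1 -> exec (While e c) s1 w2 s2 t2 ->
    exec (While e c) s (w1 ++ w2) s2 (t1 + t2).+1.

(** Input and output are in variable 0. *)
Definition runs (c : cmd) (x : data) (w : seq bool) (y : data) (t : nat) : Prop :=
  exists2 s, exec c (upd (fun=> Null) 0 x) w s t & s 0%N = y.

(** A random quantity is a relation [X w v]: the computation halts with value [v]
    after flipping exactly the coins [w], an event of probability [2 ^- size w].
    For a given infinite coin sequence at most one prefix [w] is possible, so
    that the outcomes for distinct [w] are disjoint events. *)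
Definition coin_prob (w : seq bool) : R := 2^-1 ^+ size w.

Definition almost_surely_defined (X : seq bool -> R -> Prop) : Prop :=
  (\esum_(w in [set w | exists v, X w v]) (coin_prob w)%:E = 1)%E.

Definition coin_expectation (X : seq bool -> R -> Prop) : \bar R :=
  \esum_(o in [set o : seq bool * R | X o.1 o.2]) (coin_prob o.1 * o.2)%:E.

Definition expected_at_most (X : seq bool -> R -> Prop) (b : R) : Prop :=
  almost_surely_defined X /\ (coin_expectation X <= b%:E)%E.

Fixpoint data_size (d : data) : nat :=
  if d is Pair d1 d2 then (data_size d1 + data_size d2).+1 else 1%N.

(** * Encodings *)

Fixpoint enc_list (l : seq data) : data :=
  if l is d :: l' then Pair d (enc_list l') else Null.

(** A set of elements is given by its characteristic vector. *)
Definition enc_set (T : finType) (E : {set T}) : data :=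
  enc_list [seq of_bool (e \in E) | e <- enum T].

Variable I : network R.

Definition enc_network : data :=
  Pair (enc_list [seq Num (cost e) | e <- enum (elt I)]) (nd_desc I).

Definition enc_offline (Q : seq (request I)) : data :=
  Pair enc_network (enc_list [seq nd_code q | q <- Q]).

Definition enc_timed_request (q : timed_request I) : data :=
  Pair (nd_code (treq q)) (Pair (Num (release q)) (Num (deadline q))).

Definition enc_online (s : seq (timed_request I)) : data :=
  Pair enc_network (enc_list [seq enc_timed_request q | q <- s]).

Definition enc_schedule (S : schedule I) : data :=
  enc_list [seq Pair (Num x.1) (enc_set x.2) | x <- S].

(** * Runs of an online algorithm

    The program is called once at each release, with the network, the state it
    left at its previous call and the new request.  It returns a new state
    and a plan: the transmissions that it makes from now on as long as no further
    request is released.  Only the transmissions planned for times before the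
    next release take place.  Neither the future requests nor their number are
    available to the program. *)
Definition until_next (q : timed_request I) (s : seq (timed_request I))
    (plan : schedule I) : schedule I :=
  [seq x <- plan | (release q <= x.1) &&
                   (if s is q' :: _ then x.1 < release q' else true)].

Inductive online_run (c : cmd) :
  data -> seq (timed_request I) -> seq bool -> schedule I -> nat -> Prop :=
| online_done st : online_run c st [::] [::] [::] 0
| online_step st q s w st' plan t w' S t' :
    runs c (Pair enc_network (Pair st (enc_timed_request q))) w
      (Pair st' (enc_schedule plan)) t ->
    online_run c st' s w' S t' ->
    online_run c st (q :: s) (w ++ w') (until_next q s plan ++ S) (t + t').

Definition offline_time (c : cmd) (Q : seq (request I)) : seq bool -> R -> Prop :=
  fun w v => exists y t, runs c (enc_offline Q) w y t /\ v = t%:R.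

Definition online_time (c : cmd) (s : seq (timed_request I)) :
    seq bool -> R -> Prop :=
  fun w v => exists S t, online_run c Null s w S t /\ v = t%:R.

Definition online_cost (c : cmd) (s : seq (timed_request I)) :
    seq bool -> R -> Prop :=
  fun w v => exists S t, online_run c Null s w S t /\ v = sched_cost S.

End Semantics.

(** * Algorithms *)

Inductive mode := Deterministic | Randomized.

(** For a coin-free program the only possible coin string is empty, and
    expectations are the values themselves. *)
Definition allowed (m : mode) (c : cmd) : bool :=
  if m is Deterministic then coin_free c else true.

Definition approx_algorithm (R : realType) (m : mode) (ND : network R -> Prop)
    (gamma : R) (c : cmd) : Prop :=
  [/\ allowed m c,
      forall I, ND I -> forall (Q : seq (request I)) w y t,
        runs c (enc_offline Q) w y t ->
        exists E : {set elt I}, [/\ y = enc_set R E, feasible Q E &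
          set_cost E <= gamma * opt Q] &
      exists p : {poly nat}, forall I, ND I -> forall Q : seq (request I),
        expected_at_most (offline_time c Q)
          (p.[data_size (enc_offline Q)])%:R].

(** [alpha k n] is the competitive ratio for inputs with [k] requests and [n]
    elements. *)
Definition online_algorithm (R : realType) (m : mode) (ND : network R -> Prop)
    (alpha : nat -> nat -> R) (c : cmd) : Prop :=
  [/\ allowed m c,
      forall I, ND I -> forall s : seq (timed_request I), online_input s ->
        forall w S t, online_run c Null s w S t -> sched_feasible s S,
      forall I, ND I -> forall s : seq (timed_request I), online_input s ->
        expected_at_most (online_cost c s)
          (alpha (size s) #|elt I| * opt_deadlines s) &
      exists p : {poly nat}, forall I, ND I ->
        forall s : seq (timed_request I), online_input s ->
        expected_at_most (online_time c s)
          (p.[data_size (enc_online s)])%:R].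

(* Main.v *)
Require Import Defs.
From HB Require Import structures.
From mathcomp Require Import all_boot all_order all_algebra.
From mathcomp Require Import all_classical all_reals all_analysis.
From mathcomp Require Import ring lra zify.

Set Implicit Arguments.
Unset Strict Implicit.
Unset Printing Implicit Defensive.

Import Order.TTheory GRing.Theory Num.Theory.
Local Open Scope classical_set_scope.
Local Open Scope ring_scope.

(** A pending request [q] carries a level, initially the cost of the offline
    solution for [q] alone.  When the earliest deadline expires, at a request of
    level [b], a service with budget [B = 2b] adds the pending requests of level
    below [B] in order of deadline as long as the offline solution of those taken
    so far costs at most [B], transmits that solution, and raises the level of the
    others below [B] to [B].  Hence after a service with budget [B] at time [T] a
    pending request of level below [B] must have been released after [T], and each
    level [b] is witnessed by a set of requests with optimum at least
    [b / gamma] that were released after all earlier services with budget above [b]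
    and end by the deadline.  So among the services whose witness window contains a
    given time, the budgets double.  Charging a service to the offline
    transmissions in its window, each capped at the budget and counted only if it
    exceeds a [1 / (2 (k + 1))] fraction of it, an offline transmission of cost [v]
    is charged by budgets growing geometrically, of which only [O(log k)] lie
    between [v] and [(k + 1) v].  The same argument for the single elements in place
    of the transmissions gives [O(log |E|)].  Levels are arbitrary reals that are
    only compared, added and doubled: no rounding to powers of two is needed.

    For the running time, every loop is bounded by the input size, and the coins of
    consecutive calls are combined by expressing expectations as sums over
    prefix-free sets of coin strings. *)

Local Notation eval := Defs.eval.
Local Notation Leaf := Defs.Num.
Local Notation nreg := 17.

(** * Expectations over coin strings *)

Section CoinExperiments.
Variable R : realType.

Lemma esumZl (T : choiceType) (D : set T) (r : R) (a : T -> \bar R) :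
  0 <= r -> (forall x, 0 <= a x)%E ->
  (\esum_(x in D) (r%:E * a x) = r%:E * \esum_(x in D) a x)%E.
Proof.
move=> r0 a0; rewrite /esum -ereal_supZl //; last first.
  by apply/set0P; exists (\sum_(x \in set0) a x)%E; exists set0 => //; split.
congr ereal_sup; apply/seteqP; split=> y /=.
  move=> [X [fX XD] <-]; exists (\sum_(x \in X) a x)%E; first by exists X.
  by rewrite ge0_mule_fsumr.
by move=> [_ [X [fX XD] <-] <-]; exists X => //; rewrite ge0_mule_fsumr.
Qed.

Implicit Types A B C : Type.

(** As with online costs and times, an experiment [X] with results in [A]
    relates the coins [w] that it flips to its result. *)
Definition unambiguous A (X : seq bool -> A -> Prop) : Prop :=
  forall w u a a', X w a -> X (w ++ u) a' -> u = [::] /\ a = a'.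

Lemma unambiguous_fun A (X : seq bool -> A -> Prop) w a a' :
  unambiguous X -> X w a -> X w a' -> a = a'.
Proof.
by move=> uX Xa; rewrite -(cats0 w) => Xa'; have [] := uX _ _ _ _ Xa Xa'.
Qed.

Lemma cat_eqE (T : Type) (w1 w2 w1' w2' : seq T) : w1 ++ w2 = w1' ++ w2' ->
  (exists u, w1' = w1 ++ u /\ w2 = u ++ w2') \/
  (exists u, w1 = w1' ++ u /\ w2' = u ++ w2).
Proof.
elim: w1 w1' => [|x w1 IH] [|y w1'] /=.
- by move=> ->; left; exists [::].
- by move=> ->; left; exists (y :: w1').
- by move=> <-; right; exists (x :: w1).
- case=> -> /IH [[u [-> ->]]|[u [-> ->]]]; by [left; exists u|right; exists u].
Qed.

(** Of two splittings of one string, one first part is a prefix of the other; as [X] admits no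
    proper extension of an outcome, the two coincide. *)
Lemma unambiguous_cat A (X : seq bool -> A -> Prop) w1 w2 w1' w2' a a' :
  unambiguous X -> X w1 a -> X w1' a' -> w1 ++ w2 = w1' ++ w2' ->
  [/\ w1 = w1', w2 = w2' & a = a'].
Proof.
move=> uX Xa Xa' /cat_eqE [[u [e1 e2]]|[u [e1 e2]]].
- move: Xa'; rewrite e1 => /(uX _ _ _ _ Xa) [u0 ->].
  by rewrite e2 u0 cats0.
- move: Xa; rewrite e1 => /(uX _ _ _ _ Xa') [u0 ->].
  by rewrite e2 u0 cats0.
Qed.

(** [{classic A}] supplies the choice structure that [\esum] requires of an arbitrary result
    type. *)
Definition expect A (X : seq bool -> A -> Prop) (f : A -> \bar R) : \bar R :=
  (\esum_(o in [set o : seq bool * {classic A} | X o.1 o.2])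
     ((coin_prob R o.1)%:E * f o.2))%E.

Lemma coin_prob_ge0 w : 0 <= coin_prob R w.
Proof. by rewrite exprn_ge0// invr_ge0. Qed.

Lemma coin_prob_cat w w' : coin_prob R (w ++ w') = coin_prob R w * coin_prob R w'.
Proof. by rewrite /coin_prob size_cat exprD. Qed.

Lemma le_expect A (X : seq bool -> A -> Prop) f g :
  (forall w a, X w a -> (f a <= g a)%E) -> (expect X f <= expect X g)%E.
Proof.
move=> fg; apply: le_esum => -[w a] /= Xa.
by rewrite lee_wpmul2l ?lee_fin ?coin_prob_ge0// (fg w).
Qed.

Lemma eq_expect A (X : seq bool -> A -> Prop) f g :
  (forall w a, X w a -> f a = g a) -> expect X f = expect X g.
Proof. by move=> fg; apply: eq_esum => -[w a] /= /fg ->. Qed.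

Lemma expectD A (X : seq bool -> A -> Prop) f g :
  (forall a, 0 <= f a)%E -> (forall a, 0 <= g a)%E ->
  expect X (fun a => f a + g a)%E = (expect X f + expect X g)%E.
Proof.
move=> f0 g0; rewrite /expect -esumD.
- by apply: eq_esum => o _; rewrite ge0_muleDr.
- by move=> o _; rewrite mule_ge0 ?lee_fin ?coin_prob_ge0.
- by move=> o _; rewrite mule_ge0 ?lee_fin ?coin_prob_ge0.
Qed.

Lemma expect_cst A (X : seq bool -> A -> Prop) (r : R) : 0 <= r ->
  (expect X (fun=> r%:E) = r%:E * expect X (fun=> 1))%E.
Proof.
move=> r0; rewrite /expect -esumZl//.
  by apply: eq_esum => o _; rewrite mule1 muleC.
by move=> o; rewrite mule1 lee_fin coin_prob_ge0.
Qed.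

(** Fubini for sequential composition: [coin_prob] is multiplicative on concatenations, and
    unambiguity puts the pairs of partial outcomes in bijection with the outcomes of [Y]. *)
Lemma expect_bind A B C (X : seq bool -> A -> Prop)
    (F : A -> seq bool -> B -> Prop) (g : A -> B -> C)
    (Y : seq bool -> C -> Prop) (f : C -> \bar R) :
  unambiguous X -> (forall a, unambiguous (F a)) -> (forall c, 0 <= f c)%E ->
  (forall w c, Y w c <-> exists w1 w2 a b,
     [/\ w = w1 ++ w2, X w1 a, F a w2 b & c = g a b]) ->
  expect Y f = expect X (fun a => expect (F a) (fun b => f (g a b))).
Proof.
move=> uX uF f0 defY; rewrite /expect.
under [RHS]eq_esum => o _.
  rewrite -esumZl ?coin_prob_ge0//; last first.
    by move=> o'; rewrite mule_ge0 ?lee_fin ?coin_prob_ge0.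
  over.
rewrite esum_esum; last first.
  by move=> i j _ _; rewrite !mule_ge0 ?lee_fin ?coin_prob_ge0.
rewrite (@reindex_esum _ _ _ ([set o : seq bool * {classic A} | X o.1 o.2] `*``
   (fun o : seq bool * {classic A} =>
      [set o' : seq bool * {classic B} | F o.2 o'.1 o'.2])) _
   (fun k => (k.1.1 ++ k.2.1, g k.1.2 k.2.2) : seq bool * {classic C})).
  by apply: eq_esum => -[[w1 a] [w2 b]] _ /=; rewrite coin_prob_cat EFinM muleA.
split=> /=.
- move=> [[w1 a] [w2 b]] [/= Xa Fb]; apply/defY.
  by exists w1, w2, a, b.
- move=> [[w1 a] [w2 b]] [[w1' a'] [w2' b']] /set_mem[/= Xa Fb] /set_mem[/= Xa' Fb'].
  case=> /(unambiguous_cat uX Xa Xa')[e1 e2 e3] _; subst w1' w2' a'.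
  by rewrite (unambiguous_fun (uF a) Fb Fb').
- move=> [w c] /= /defY[w1 [w2 [a [b [-> Xa Fb ->]]]]].
  by exists ((w1, a), (w2, b)).
Qed.

Lemma unambiguous_bind A B C (X : seq bool -> A -> Prop)
    (F : A -> seq bool -> B -> Prop) (g : A -> B -> C) (Y : seq bool -> C -> Prop) :
  unambiguous X -> (forall a, unambiguous (F a)) ->
  (forall w c, Y w c -> exists w1 w2 a b,
     [/\ w = w1 ++ w2, X w1 a, F a w2 b & c = g a b]) ->
  unambiguous Y.
Proof.
move=> uX uF defY w u c c' /defY[w1 [w2 [a [b [-> Xa Fb ->]]]]].
move=> /defY[w1' [w2' [a' [b' [e Xa' Fb' ->]]]]].
rewrite -catA in e.
have [e1 e2 e3] := unambiguous_cat uX Xa Xa' e; subst w1' w2' a'.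
by have [-> ->] := uF _ _ _ _ _ Fb Fb'.
Qed.

(** The mass condition expresses almost sure termination. [Q] is demanded of every outcome, since
    feasibility of the online schedule must hold always and not only with probability one. *)
Definition terminates A (X : seq bool -> A -> Prop) (tm : A -> nat)
    (Q : A -> Prop) (b : nat) : Prop :=
  [/\ forall w a, X w a -> Q a, expect X (fun=> 1%E) = 1%E &
      (expect X (fun a => (tm a)%:R%:E) <= b%:R%:E)%E].

Lemma natE_ge0 n : (0 <= (n%:R : R)%:E)%E.
Proof. by rewrite lee_fin. Qed.

Lemma terminates_sub A (X : seq bool -> A -> Prop) tm (Q Q' : A -> Prop) b b' :
  terminates X tm Q b -> (forall a, Q a -> Q' a) -> (b <= b')%N ->
  terminates X tm Q' b'.
Proof.
move=> [XQ X1 Xb] QQ' bb'; split=> //; first by move=> w a /XQ/QQ'.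
by apply: le_trans Xb _; rewrite lee_fin ler_nat.
Qed.

(** Linearity of expectation; [b2] bounds the second part uniformly over the results of the first,
    and [k] counts the steps of the composition itself. *)
Lemma terminates_bind A B C (X : seq bool -> A -> Prop)
    (F : A -> seq bool -> B -> Prop) (g : A -> B -> C) (Y : seq bool -> C -> Prop)
    tmX tmF tmY (k : nat) P Q b1 b2 :
  unambiguous X -> (forall a, unambiguous (F a)) ->
  (forall w c, Y w c <-> exists w1 w2 a b,
     [/\ w = w1 ++ w2, X w1 a, F a w2 b & c = g a b]) ->
  (forall a b, tmY (g a b) = tmX a + tmF b + k)%N ->
  terminates X tmX P b1 ->
  (forall a, P a -> terminates (F a) tmF (fun b => Q (g a b)) b2) ->
  terminates Y tmY Q (b1 + b2 + k).
Proof.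
move=> uX uF defY tmE [XP X1 Xb] PF; split.
- move=> w c /defY[w1 [w2 [a [b [_ Xa Fb ->]]]]].
  by have [FQ _ _] := PF _ (XP _ _ Xa); apply: FQ Fb.
- rewrite (expect_bind uX uF _ defY)// -[RHS]X1; apply: eq_expect => w a Xa.
  by have [] := PF _ (XP _ _ Xa).
rewrite (expect_bind uX uF (fun c => natE_ge0 _) defY).
(* The second experiment is integrated out first; it has mass one, so the constant [tmX a + k]
   passes through. *)
apply: (@le_trans _ _ (expect X (fun a => (tmX a)%:R%:E + (b2 + k)%:R%:E)))%E.
  apply: le_expect => w a Xa; have [_ F1 Fb] := PF _ (XP _ _ Xa).
  rewrite (_ : (fun b => _) = (fun b => (tmF b)%:R%:E + (tmX a + k)%:R%:E)%E).
    rewrite expectD; do 2?[by move=> *; exact: natE_ge0].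
    by rewrite expect_cst// F1 mule1 -EFinD -natrD addnCA (natrD _ b2) EFinD leeD2r.
  by apply/funext => c; rewrite tmE -EFinD -natrD addnAC addnC.
rewrite expectD; do 2?[by move=> *; exact: natE_ge0].
by rewrite expect_cst// X1 mule1 -addnA (natrD _ b1) EFinD leeD2r.
Qed.

Lemma terminates_ret A (X : seq bool -> A -> Prop) tm (Q : A -> Prop) b a :
  (forall w a', X w a' <-> w = [::] /\ a' = a) -> Q a -> (tm a <= b)%N ->
  terminates X tm Q b.
Proof.
move=> defX Qa tmb.
have expE f : (forall a, 0 <= f a)%E -> expect X f = f a.
  move=> f0; rewrite /expect (_ : [set o | _] = [set ([::], a : {classic A})]).
    by rewrite esum_set1 /coin_prob /= ?expr0 mul1e.
  apply/seteqP; split=> -[w a'] /=; first by move=> /defX[-> ->].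
  by case=> -> ->; apply/defX.
split; first by move=> w a' /defX[_ ->].
- by rewrite expE// => _; rewrite lee01.
- by rewrite expE ?lee_fin ?ler_nat// => a'; exact: natE_ge0.
Qed.

Lemma terminates_ex A (X : seq bool -> A -> Prop) tm Q b :
  terminates X tm Q b -> exists w a, X w a.
Proof.
move=> [_ X1 _]; apply: contrapT => nX.
have : expect X (fun=> 1%E) = 0%E.
  apply: esum1 => -[w a] /= Xa; case: nX; by exists w, a.
by rewrite X1 => /eqP; rewrite onee_eq0.
Qed.

(* The coins determine the result, so that summing over coins, over results or
   over values is the same. *)
Lemma expected_at_mostP A (X : seq bool -> A -> Prop) (f : A -> R)
    (Y : seq bool -> R -> Prop) (b : R) :
  unambiguous X -> (forall w v, Y w v <-> exists2 a, X w a & v = f a) ->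
  expected_at_most Y b <->
  expect X (fun=> 1%E) = 1%E /\ (expect X (fun a => (f a)%:E) <= b%:E)%E.
Proof.
move=> uX defY.
have -> : expect X (fun a => (f a)%:E) = coin_expectation Y.
  rewrite /coin_expectation.
  rewrite (@reindex_esum _ _ _ [set o : seq bool * {classic A} | X o.1 o.2] _
     (fun o => (o.1, f o.2))).
    by apply: eq_esum => -[w a] _ /=; rewrite EFinM.
  split=> /=.
  - by move=> [w a] /= Xa; apply/defY; exists a.
  - move=> [w a] [w' a'] /set_mem/= Xa /set_mem/= Xa' [e _]; subst w'.
    by rewrite (unambiguous_fun uX Xa Xa').
  - by move=> [w v] /= /defY[a Xa ->]; exists (w, a).
rewrite /expected_at_most /almost_surely_defined.
suff -> : expect X (fun=> 1%E) =
   (\esum_(w in [set w | exists v, Y w v]) (coin_prob R w)%:E)%E by [].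
rewrite (@reindex_esum _ _ _ [set o : seq bool * {classic A} | X o.1 o.2] _ fst).
  by apply: eq_esum => o _; rewrite mule1.
split=> /=.
- by move=> [w a] /= Xa; exists (f a); apply/defY; exists a.
- move=> [w a] [w' a'] /set_mem/= Xa /set_mem/= Xa' e; subst w'.
  by rewrite (unambiguous_fun uX Xa Xa').
- by move=> w /= [v /defY[a Xa _]]; exists (w, a).
Qed.

End CoinExperiments.

(** * Charging *)

Section Charging.
Variable R : realType.
Implicit Types (b v t th : R) (x y it : R * R) (h items : seq (R * R)).

(** Apply [ln y <= y - 1] to [y = 1 - b / (v + 2 b)], the inverse quotient of the two arguments: the
    difference of logarithms is at least [b / (v + 2 b)]. The factor 3 comes from the case
    [b = v]. *)
Lemma min_le_ln_double b v : 0 <= b -> 0 < v ->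
  Num.min v b <= 3 * v * (ln (1 + 2 * b / v) - ln (1 + b / v)).
Proof.
move=> b0 v0.
have vb : 0 < v + b by lra.
have v2b : 0 < v + 2 * b by lra.
have bv0 : 0 <= b / v by rewrite divr_ge0// ltW.
have b1 : 0 < 1 + b / v by lra.
have b2 : 0 < 1 + 2 * b / v by rewrite -mulrA; lra.
rewrite -ln_div//.
have -> : (1 + 2 * b / v) / (1 + b / v) = (1 - b / (v + 2 * b))^-1.
  have ? : v + b - b + b != 0 by lra.
  by field; rewrite ?lt0r_neq0//; lra.
rewrite lnV; last first.
  rewrite posrE (_ : 1 - _ = (v + b) / (v + 2 * b)) ?divr_gt0//.
  by field; rewrite lt0r_neq0.
have : ln (1 + - (b / (v + 2 * b))) <= - (b / (v + 2 * b)).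
  by apply: le_ln1Dx; rewrite ltrN2 ltr_pdivrMr//; lra.
move: (ln _) => l /= hl.
apply: (@le_trans _ _ (3 * v * (b / (v + 2 * b)))); last first.
  by rewrite ler_pM2l; lra.
by rewrite mulrA ler_pdivlMr//; have [vb'|bv'] := leP v b; nra.
Qed.

(** A service is a pair of a budget and a time; histories list the latest
    service first. *)
Definition window x h t : bool :=
  (t <= x.2) && all (fun y => (x.1 < 2 * y.1) ==> (y.2 < t)) h.

(** [th] is a cutoff: smaller contributions are replaced by [N * th] in total, with [N] the number
    of requests when items are whole transmissions and the number of elements when they are single
    elements. *)
Fixpoint covered (N : nat) items h : Prop :=
  if h is x :: h' then
    (0 <= x.1 /\
    forall th, 0 <= th ->
      x.1 <= N%:R * th + \sum_(it <- items | window x h' it.1 && (th < it.2)) it.2)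
    /\ covered N items h'
  else True.

(** The charge on one item. [M] drops the services for which the item is a negligible share of the
    budget; the cap at [x.1] keeps small budgets from charging the full value. *)
Fixpoint load (M : R) h it : R :=
  if h is x :: h' then
    (if window x h' it.1 && (x.1 < M * it.2) then Num.min it.2 x.1 else 0) +
    load M h' it
  else 0.

(* The budgets of the windows containing a given time double, so each of them is
   paid by the increase of [3 v ln (1 + b / v)]. *)
Lemma load_le (M : R) h it b : 0 < it.2 -> 0 <= b ->
  (forall x, x \in h -> 0 <= x.1) ->
  (forall x, x \in h -> it.1 <= x.2 -> x.1 < M * it.2 -> 2 * x.1 <= b) ->
  load M h it <= 3 * it.2 * ln (1 + b / it.2).
Proof.
case: it => t v /=; elim: h b => [|x h IH] b v0 b0 h0 hb /=.
  rewrite mulr_ge0// ?mulr_ge0 ?(ltW v0)//.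
  by rewrite ln_ge0// lerDl divr_ge0// ltW.
have IHh b' : 0 <= b' -> (forall x, x \in h -> t <= x.2 -> x.1 < M * v ->
    2 * x.1 <= b') -> load M h (t, v) <= 3 * v * ln (1 + b' / v).
  by move=> *; apply: IH => // y yh; apply: h0; rewrite inE yh orbT.
case: ifP => [/andP[/andP[tx /allP xw] xM]|_]; last first.
  by rewrite add0r; apply: IHh => // y yh; apply: hb; rewrite inE yh orbT.
have x0 : 0 <= x.1 by apply: h0; rewrite mem_head.
have x2b : 2 * x.1 <= b by apply: hb => //; rewrite mem_head.
(* The window of [x] excludes every earlier service at or after [t] with more than half the budget
   of [x], so the induction hypothesis applies with [x.1] as the bound. *)
have : load M h (t, v) <= 3 * v * ln (1 + x.1 / v).
  apply: IHh => // y yh ty yM.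
  have := xw _ yh; rewrite (ltNge y.2) ty /= implybF -leNgt //.
have := min_le_ln_double x0 v0.
have : 3 * v * ln (1 + 2 * x.1 / v) <= 3 * v * ln (1 + b / v).
  rewrite ler_pM2l ?mulr_gt0// ler_ln ?posrE ?lerD2l ?ler_pM2r ?invr_gt0//.
  - by rewrite ltr_pwDl// divr_ge0// ?mulr_ge0// ltW.
  - by rewrite ltr_pwDl// divr_ge0// ltW.
lra.
Qed.

(** If no summand exceeds [b], the caps change nothing; otherwise one capped summand alone is
    [b]. *)
Lemma le_sum_capped (T : Type) (b : R) (r : seq T) (P : pred T) (f : T -> R) :
  0 <= b -> (forall i, 0 <= f i) ->
  Num.min b (2 * \sum_(i <- r | P i) f i) <=
  2 * \sum_(i <- r | P i) Num.min (f i) b.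
Proof.
move=> b0 f0; rewrite ge_min; elim: r => [|i r IH].
  by rewrite !big_nil lexx orbT.
rewrite !big_cons; case: (P i) => //.
have s0 : 0 <= \sum_(j <- r | P j) Num.min (f j) b.
  by apply: sumr_ge0 => j _; rewrite le_min f0.
have := f0 i; case: (leP (f i) b) => hf fi; move: IH => /orP[] IH;
  apply/orP; [left|right|left|left]; lra.
Qed.

(** The items above a suitable cutoff cover at least half of each budget, and [le_sum_capped] allows
    capping them; exchanging the sums over services and items gives the loads. *)
Lemma sum_covered_le N items h : covered N items h ->
  (forall it, it \in items -> 0 <= it.2) ->
  \sum_(x <- h) x.1 <= 2 * \sum_(it <- items) load (2 * N.+1%:R) h it.
Proof.
move=> ch it0.
elim: h ch => [|x h IH] /=; first by rewrite big_nil big1_eq mulr0.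
move=> [[x0 xch] /IH]; rewrite big_cons big_split /= mulrDr.
suff : x.1 <= 2 * \sum_(it <- items) (if window x h it.1 &&
    (x.1 < 2 * N.+1%:R * it.2) then Num.min it.2 x.1 else 0) by lra.
have N0 : 0 < (N.+1%:R : R) by [].
(* With this cutoff [N * th] is at most half the budget, and [th < it.2] is the condition of [load]
   for [M = 2 (N + 1)]. The successor avoids a division by zero. *)
pose th := x.1 / (2 * N.+1%:R).
have th0 : 0 <= th by rewrite divr_ge0// mulr_ge0// ltW.
have Nth : N%:R * th <= x.1 / 2.
  have -> : x.1 / 2 = N.+1%:R * th by rewrite /th; field; rewrite lt0r_neq0.
  by rewrite ler_wpM2r// ler_nat.
rewrite -big_mkcond /=; have := xch _ th0.
(* Absolute values, because [le_sum_capped] asks for nonnegative values at every index while [it0]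
   speaks of members of [items]. *)
have -> : \sum_(it <- items | window x h it.1 && (th < it.2)) it.2 =
    \sum_(it <- items | window x h it.1 && (x.1 < 2 * N.+1%:R * it.2)) `|it.2|.
  rewrite big_seq_cond [RHS]big_seq_cond; apply: eq_big => it.
    by rewrite ltr_pdivrMr ?mulr_gt0// (mulrC it.2).
  by move=> /andP[/it0 ? _]; rewrite ger0_norm.
have -> : \sum_(it <- items | window x h it.1 && (x.1 < 2 * N.+1%:R * it.2))
      Num.min it.2 x.1 =
    \sum_(it <- items | window x h it.1 && (x.1 < 2 * N.+1%:R * it.2))
      Num.min `|it.2| x.1.
  rewrite big_seq_cond [RHS]big_seq_cond; apply: eq_bigr => it.
  by move=> /andP[/it0 ? _]; rewrite ger0_norm.
move=> xle.
have := @le_sum_capped _ x.1 items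
  (fun it => window x h it.1 && (x.1 < 2 * N.+1%:R * it.2)) (fun it => `|it.2|) x0
  (fun it => normr_ge0 _).
rewrite ge_min /= => /orP[//|].
have aux (u y S S' : R) : u <= y + S -> y <= u / 2 -> 2 * S <= S' -> u <= S' by lra.
exact: aux xle Nth.
Qed.

(** For [N >= 1] the argument is at most [9 N]; for [N = 0] it is 5, and [ln 0 = 0]. Both cases end
    with [ln 9 <= 3]. *)
Lemma ln_quad_le (N : nat) : ln (1 + 2 * (2 * N.+1%:R)) <= 3 * (1 + ln N%:R) :> R.
Proof.
have ln_le (y : R) : 0 < y -> ln y <= y - 1.
  by move=> y0; have := @le_ln1Dx R (y - 1); rewrite addrCA subrr addr0; apply; lra.
have l9 : ln (9 : R) <= 3.
  (* Factors close to 1, where [ln y <= y - 1] loses little: [4 / 2 + 7 / 9 < 3]. *)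
  have -> : (9 : R) = (3 / 2) ^+ 4 * (16 / 9) by field.
  rewrite lnM ?posrE ?exprn_gt0//; try lra.
  rewrite lnXn; last by lra.
  have := ln_le (3 / 2) _; have := ln_le (16 / 9) _; rewrite -mulr_natr; lra.
case: N => [|N].
  rewrite [ln 0%:R]ln0// addr0 mulr1; apply: le_trans l9.
  by rewrite ler_ln ?posrE; lra.
apply: (@le_trans _ _ (ln (9 * N.+1%:R))).
  have : (N.+1%:R : R) >= 1 by rewrite ler1n.
  rewrite -(natr1 N.+1) => N1; rewrite ler_ln ?posrE; lra.
have : 0 <= ln (N.+1%:R : R) by rewrite ln_ge0// ler1n.
by rewrite lnM ?posrE ?ltr0n//; lra.
Qed.

(** Only budgets below [M v] load an item of value [v], so [load_le] applies with [b = 2 M v] and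
    its logarithm becomes independent of [v]. The constant is [2 * 3 * 3]. *)
Lemma sum_covered_le_ln N items h : covered N items h ->
  (forall it, it \in items -> 0 <= it.2) ->
  \sum_(x <- h) x.1 <= 18 * (1 + ln N%:R) * \sum_(it <- items) it.2.
Proof.
move=> ch it0; apply: le_trans (sum_covered_le ch it0) _.
have h0 : forall x, x \in h -> 0 <= x.1.
  elim: h ch => [|y h IH] //= [[y0 _] /IH ch] x.
  by rewrite inE => /predU1P[->//|/ch].
have M0 : 0 < 2 * N.+1%:R :> R by rewrite mulr_gt0.
have -> : 18 * (1 + ln N%:R) * \sum_(it <- items) it.2 =
  2 * (\sum_(it <- items) 3 * it.2 * (3 * (1 + ln N%:R))) :> R.
  by rewrite -mulr_suml -mulr_sumr; ring.
rewrite ler_pM2l// big_seq [leRHS]big_seq; apply: ler_sum => it /it0.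
(* An item of value zero carries no load, as no budget is negative; [load_le] is for positive
   values. *)
rewrite le_eqVlt => /predU1P[it2|v0].
  rewrite -it2 mulr0 mul0r; elim: h h0 {ch} => //= x h IH h0.
  rewrite -it2 mulr0 ltNge h0 ?mem_head// andbF add0r.
  by apply: IH => y yh; apply: h0; rewrite inE yh orbT.
have := @load_le (2 * N.+1%:R) h it (2 * (2 * N.+1%:R) * it.2) v0.
rewrite mulfK ?lt0r_neq0//.
move=> /(_ _ h0) h1.
apply: (le_trans (h1 _ _)).
- by rewrite !mulr_ge0// ltW.
- by move=> x xh _ xM; lra.
- by rewrite ler_pM2l ?mulr_gt0// ln_quad_le.
Qed.

End Charging.

(** * The algorithm *)

(** [psol] is the offline solution for this request alone; a service triggered by the request starts
    from it. *)
Record pending (R : realType) (I : network R) := Pending {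
  ptr : timed_request I;
  plevel : R;
  psol : {set elt I}
}.

HB.instance Definition _ (R : realType) (I : network R) :=
  gen_eqMixin (timed_request I).
HB.instance Definition _ (R : realType) (I : network R) :=
  gen_eqMixin (pending I).

Section Algorithm.
Variables (R : realType) (I : network R) (gamma : R).
Implicit Types (p : pending I) (P Q K : seq (pending I)) (E : {set elt I})
  (q : timed_request I) (B : R) (h : seq (R * R)) (s : seq (timed_request I)).

Definition reqs Q : seq (request I) := [seq treq (ptr p) | p <- Q].

(** A relation rather than a function: a randomized algorithm may return different solutions for the
    same requests. *)
Definition approx_sol (Q : seq (request I)) E : Prop :=
  feasible Q E /\ set_cost E <= gamma * opt Q.

Definition raise B p : pending I := Pending (ptr p) B (psol p).

(** [scan B Q E full P E' K]: the requests [Q] are served by [E] so far and [P]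
    remains to be examined; once the budget is exceeded, [full] is set.  In the
    end [E'] is transmitted and [K] remains pending. *)
Inductive scan B : seq (pending I) -> {set elt I} -> bool -> seq (pending I) ->
    {set elt I} -> seq (pending I) -> Prop :=
| scan_nil Q E full : scan B Q E full [::] E [::]
| scan_high Q E full p P E' K : B <= plevel p ->
    scan B Q E full P E' K -> scan B Q E full (p :: P) E' (p :: K)
| scan_full Q E p P E' K : plevel p < B ->
    scan B Q E true P E' K -> scan B Q E true (p :: P) E' (raise B p :: K)
| scan_serve Q E p P E1 E' K : plevel p < B ->
    approx_sol (reqs (p :: Q)) E1 -> set_cost E1 <= B ->
    scan B (p :: Q) E1 false P E' K -> scan B Q E false (p :: P) E' K
| scan_stop Q E p P E1 E' K : plevel p < B ->
    approx_sol (reqs (p :: Q)) E1 -> B < set_cost E1 ->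
    scan B Q E true P E' K -> scan B Q E false (p :: P) E' (raise B p :: K).

Inductive service : seq (pending I) -> R * {set elt I} -> R -> seq (pending I) ->
    Prop :=
| Service p P E K : scan (2 * plevel p) [:: p] (psol p) false P E K ->
    service (p :: P) (deadline (ptr p), E) (2 * plevel p) K.

Definition cur P (snaps : seq (R * seq (pending I))) : seq (pending I) :=
  if snaps is y :: _ then y.2 else P.

(** Planned services, with the requests pending after each of them; the latest
    comes first. *)
Inductive planned P : seq (R * seq (pending I)) -> schedule I -> Prop :=
| planned_nil : planned P [::] [::]
| planned_cons snaps plan x B K : planned P snaps plan ->
    service (cur P snaps) x B K -> planned P ((x.1, K) :: snaps) (x :: plan).

(** A request released at [r] cancels the services planned for [r] or later: the state rolls back to
    the last snapshot before [r]. *)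
Fixpoint popped (r : R) (snaps : seq (R * seq (pending I))) :=
  if snaps is y :: snaps' then
    if r <= y.1 then popped r snaps' else snaps
  else [::].

Fixpoint insert p P : seq (pending I) :=
  if P is p' :: P' then
    if deadline (ptr p') <= deadline (ptr p) then p' :: insert p P' else p :: P
  else [:: p].

Definition by_deadline : rel (timed_request I) :=
  fun q q' => deadline q <= deadline q'.

Definition serves (x : R * {set elt I}) q : bool :=
  (release q <= x.1 <= deadline q) && (x.2 \in sat (treq q)).

Lemma by_deadline_trans : transitive by_deadline.
Proof. by move=> q q' q''; apply: le_trans. Qed.

Lemma scan_cost B Q E full P E' K : scan B Q E full P E' K ->
  set_cost E <= B -> set_cost E' <= B.
Proof. by elim=> {Q E full P E' K} // *; auto. Qed.

(** Each new solution serves all requests taken so far. Requests that remain are identified through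
    [ptr], since raising changes the level. *)
Lemma scan_sat B Q E full P E' K : scan B Q E full P E' K ->
  feasible (reqs Q) E ->
  feasible (reqs Q) E' /\
  forall p, p \in P -> E' \in sat (treq (ptr p)) \/ ptr p \in map (@ptr R I) K.
Proof.
elim=> {Q E full P E' K}.
- by move=> Q E full QE; split=> // p; rewrite in_nil.
- move=> Q E full p P E' K _ _ IH /IH[QE' PE']; split=> // p'; rewrite inE.
  move=> /predU1P[->|/PE' [?|?]]; [right|by left|right].
    by rewrite mem_head.
  by rewrite inE orbC; apply/orP; left.
- move=> Q E p P E' K _ _ IH /IH[QE' PE']; split=> // p'; rewrite inE.
  move=> /predU1P[->|/PE' [?|?]]; [right|by left|right].
    by rewrite mem_head.
  by rewrite inE orbC; apply/orP; left.
- move=> Q E p P E1 E' K _ [QE1 _] _ _ IH _; have [/= /andP[pE' QE'] PE'] := IH QE1.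
  by split=> // p'; rewrite inE => /predU1P[->|/PE'//]; left.
- move=> Q E p P E1 E' K _ _ _ _ IH /IH[QE' PE']; split=> // p'; rewrite inE.
  move=> /predU1P[->|/PE' [?|?]]; [right|by left|right].
    by rewrite mem_head.
  by rewrite inE orbC; apply/orP; left.
Qed.

Lemma scan_subseq B Q E full P E' K : scan B Q E full P E' K ->
  subseq (map (@ptr R I) K) (map (@ptr R I) P).
Proof.
elim=> {Q E full P E' K} //=; try by move=> *; rewrite eqxx.
move=> Q E p P E1 E' K _ _ _ _ IH.
by apply: subseq_trans IH (subseq_cons _ _).
Qed.

(** The witness for a level raised to [B]: the offline solution for [W] cost more than [B]. The
    bound [m] on its size is what later brings in the number of requests. *)
Definition unaffordable B (ok : pending I -> Prop) (m : nat) p : Prop :=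
  exists W : seq (pending I),
    [/\ (size W <= m)%N, forall w, w \in W -> ok w,
        forall w, w \in W -> by_deadline (ptr w) (ptr p) &
        B <= gamma * opt (reqs W)].

(** The requests taken so far and the one that overflows the budget form a witness, shared by all
    later requests because their deadlines are no earlier. The hypothesis on [full] hands it down
    the induction. *)
Lemma scan_raised B ok m Q E full P E' K : scan B Q E full P E' K ->
  sorted by_deadline (map (@ptr R I) P) ->
  (forall w p, w \in Q -> p \in P -> by_deadline (ptr w) (ptr p)) ->
  (forall w, w \in Q -> ok w) ->
  (forall p, p \in P -> plevel p < B -> ok p) ->
  (full = true -> forall p, p \in P -> unaffordable B ok m p) ->
  (size Q + size P <= m)%N ->
  forall p, p \in K -> (p \in P /\ B <= plevel p) \/
    exists2 p', p' \in P & [/\ p = raise B p', plevel p' < B &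
                               unaffordable B ok m p].
Proof.
have pathP p0 P0 : path by_deadline (ptr p0) (map (@ptr R I) P0) ->
    forall p', p' \in P0 -> by_deadline (ptr p0) (ptr p').
  move=> /(order_path_min by_deadline_trans)/allP ptrP p' p'P.
  by apply: ptrP; apply: map_f.
have liftP p0 P0 K' (U : pending I -> Prop) :
    (forall p1, p1 \in K' -> (p1 \in P0 /\ B <= plevel p1) \/
      exists2 p', p' \in P0 & [/\ p1 = raise B p', plevel p' < B & U p1]) ->
    (forall p1, p1 \in K' -> (p1 \in p0 :: P0 /\ B <= plevel p1) \/
      exists2 p', p' \in p0 :: P0 & [/\ p1 = raise B p', plevel p' < B & U p1]).
  move=> H p1 /H[[p1P Bp1]|[p' p'P ?]].
    by left; rewrite inE p1P orbT.
  by right; exists p' => //; rewrite inE p'P orbT.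
have mem_tl (T : eqType) (x y : T) (l : seq T) : x \in l -> x \in y :: l.
  by rewrite inE orbC => ->.
elim=> {Q E full P E' K} //.
- move=> Q E full p P E' K Bp _ IH /= sP QP okQ okP fullP sz p1.
  rewrite inE => /predU1P[->|].
    by left; rewrite mem_head.
  apply: liftP; apply: IH => //.
  + exact: path_sorted sP.
  + by move=> w p' wQ p'P; apply: QP => //; apply: mem_tl.
  + by move=> p' p'P; apply: okP; apply: mem_tl.
  + by move=> /fullP f p' p'P; apply: f; apply: mem_tl.
  + by apply: leq_trans sz; rewrite /= addnS.
- move=> Q E p P E' K Bp _ IH /= sP QP okQ okP fullP sz p1.
  rewrite inE => /predU1P[->|].
    right; exists p; first exact: mem_head.
    by split=> //; exact: (fullP erefl p (mem_head _ _)).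
  apply: liftP; apply: IH => //.
  + exact: path_sorted sP.
  + by move=> w p' wQ p'P; apply: QP => //; apply: mem_tl.
  + by move=> p' p'P; apply: okP; apply: mem_tl.
  + by move=> /fullP f p' p'P; apply: f; apply: mem_tl.
  + by apply: leq_trans sz; rewrite /= addnS.
- move=> Q E p P E1 E' K Bp _ _ _ IH /= sP QP okQ okP _ sz p1.
  apply: liftP; apply: IH => //.
  + exact: path_sorted sP.
  + move=> w p'; rewrite inE => /predU1P[->|wQ] p'P; first exact: pathP sP _ _.
    by apply: QP => //; apply: mem_tl.
  + move=> w; rewrite inE => /predU1P[->|/okQ//].
    by apply: okP; rewrite ?mem_head.
  + by move=> p' p'P; apply: okP; apply: mem_tl.
  + by rewrite /= addSnnS.
- move=> Q E p P E1 E' K Bp [_ E1le] BE1 _ IH /= sP QP okQ okP _ sz.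
  have Up p' : p' \in p :: P -> unaffordable B ok m p'.
    move=> p'P; exists (p :: Q); split.
    + by apply: leq_trans sz; rewrite /= addnS ltnS leq_addr.
    + move=> w; rewrite inE => /predU1P[->|/okQ//].
      by apply: okP; rewrite ?mem_head.
    + move=> w; rewrite inE => /predU1P[->|wQ]; last by apply: QP.
      by move: p'P; rewrite inE => /predU1P[->|/(pathP _ _ sP)//]; apply: lexx.
    + by apply: le_trans E1le; apply: ltW.
  move=> p1; rewrite inE => /predU1P[->|].
    right; exists p; first exact: mem_head.
    by split=> //; exact: (Up p (mem_head _ _)).
  apply: liftP; apply: IH => //.
  + exact: path_sorted sP.
  + by move=> w p' wQ p'P; apply: QP => //; apply: mem_tl.
  + by move=> p' p'P; apply: okP; apply: mem_tl.
  + by move=> _ p' p'P; apply: Up; apply: mem_tl.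
  + by apply: leq_trans sz; rewrite /= addnS.
Qed.

End Algorithm.

(** * Competitive analysis *)

Section Analysis.
Variables (R : realType) (I : network R) (gamma : R).
Implicit Types (p : pending I) (P K : seq (pending I)) (E : {set elt I})
  (q : timed_request I) (B : R) (h : seq (R * R)) (s Q : seq (timed_request I)).

Definition set_opt Q : R := opt [seq treq q | q <- Q].

Lemma set_cost_ge0 E : 0 <= set_cost E.
Proof. by apply: sumr_ge0 => e _; apply: cost_ge0. Qed.

Lemma opt_le (Q : seq (request I)) E : feasible Q E -> opt Q <= set_cost E.
Proof.
move=> QE; apply: ge_inf; last by exists E.
by exists 0 => _ [E' _ <-]; apply: set_cost_ge0.
Qed.

Lemma opt_ge0 (Q : seq (request I)) : 0 <= opt Q.
Proof.
(* For unsatisfiable requests the infimum is over the empty set and is 0 by convention. *)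
rewrite /opt; have [->|/set0P ne] := eqVneq [set E | feasible Q E]
  (set0 : set {set elt I}).
  by rewrite image_set0 inf0.
apply: lb_le_inf; first by case: ne => E QE; exists (set_cost E); exists E.
by move=> _ [E' _ <-]; apply: set_cost_ge0.
Qed.

(** The offline lower bound carried by the level of a pending request, or by a
    service: a set of requests ending by time [t] whose optimum is at least
    [B / gamma], all released after the services with budget above [bound]. *)
Definition evidence s h (B bound t : R) : Prop :=
  exists Q, [/\ (size Q <= size s)%N, {subset Q <= s},
    forall q, q \in Q -> deadline q <= t, B <= gamma * set_opt Q &
    forall x, x \in h -> bound < x.1 -> forall q, q \in Q -> x.2 < release q].

(** [level_release] is the doubling mechanism: a request already pending at a service with a larger
    budget would have been served or raised there. *)
Record level_ok s h p : Prop := LevelOk {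
  level_mem : ptr p \in s;
  level_sat : psol p \in sat (treq (ptr p));
  level_cost : set_cost (psol p) <= plevel p;
  level_evidence : evidence s h (plevel p) (plevel p) (deadline (ptr p));
  level_release : forall x, x \in h -> plevel p < x.1 -> x.2 < release (ptr p)
}.

Record inv s h (now : R) P : Prop := Inv {
  inv_sorted : sorted (@by_deadline R I) (map (@ptr R I) P);
  inv_size : (size P <= size s)%N;
  inv_level : forall p, p \in P -> level_ok s h p;
  inv_release : forall p, p \in P -> release (ptr p) <= now;
  inv_deadline : forall p, p \in P -> now <= deadline (ptr p)
}.

(** The budget is twice the level of the expiring request, hence evidence for half of it. *)
Fixpoint justified s h : Prop :=
  if h is x :: h' then
    (0 <= x.1 /\ evidence s h' (x.1 / 2) (x.1 / 2) x.2) /\ justified s h'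
  else True.

Lemma sorted_by_deadline p P : sorted (@by_deadline R I) (map (@ptr R I) (p :: P)) ->
  forall p', p' \in p :: P -> deadline (ptr p) <= deadline (ptr p').
Proof.
move=> /= /(order_path_min (@by_deadline_trans R I))/allP ptrP p'.
rewrite inE => /predU1P[->//|p'P].
by apply: ptrP; apply: map_f.
Qed.

Lemma service_inv s h now P x B K : inv s h now P -> service gamma P x B K ->
  [/\ inv s ((B, x.1) :: h) now K,
      0 <= B /\ evidence s h (B / 2) (B / 2) x.1,
      set_cost x.2 <= B,
      now <= x.1 /\ forall p, p \in P -> x.1 <= deadline (ptr p) &
      forall p, p \in P -> serves x (ptr p) \/ ptr p \in map (@ptr R I) K].
Proof.
move=> iP xBK; case: xBK iP => {P x B K} p0 P E K sc iP.
have p0P : p0 \in p0 :: P by rewrite mem_head.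
have lv0 := inv_level iP p0P.
have b0 : 0 <= plevel p0 by apply: le_trans (level_cost lv0); apply: set_cost_ge0.
have dl := sorted_by_deadline (inv_sorted iP).
have tl p : p \in P -> p \in p0 :: P by rewrite inE orbC => ->.
have subK := scan_subseq sc.
have memK p : p \in K -> exists2 p', p' \in P & ptr p = ptr p'.
  by move=> /(map_f (@ptr R I))/(mem_subseq subK)/mapP.
have halfB : 2 * plevel p0 / 2 = plevel p0 by rewrite mulrC mulKf.
have sP : sorted (@by_deadline R I) (map (@ptr R I) P).
  by have := inv_sorted iP; apply: path_sorted.
split=> /=.
- split.
  + exact: subseq_sorted (@by_deadline_trans R I) _ _ subK sP.
  + have := inv_size iP; apply: leq_trans => /=.
    by have := size_subseq subK; rewrite !size_map => /leqW.
  (* The guard covers an expiring request of level zero, which is not below its own budget; then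
     nothing is raised, levels being nonnegative. *)
  + pose ok p := p \in p0 :: P /\ (0 < 2 * plevel p0 -> plevel p < 2 * plevel p0).
    move=> p pK.
    have [] : (p \in P /\ 2 * plevel p0 <= plevel p) \/
        exists2 p', p' \in P & [/\ p = raise (2 * plevel p0) p',
          plevel p' < 2 * plevel p0 &
          unaffordable gamma (2 * plevel p0) ok (size P).+1 p].
      apply: (@scan_raised _ _ _ _ _ _ _ _ _ _ _ _ sc) => //.
      - by move=> w p'; rewrite inE => /eqP-> p'P; apply/dl/tl.
      - by move=> w; rewrite inE => /eqP->; split=> // b1; lra.
      - by move=> w wP wB; split; first exact: tl.
    * move=> [pP Bp]; have [lm ls lc [Q [Qs Qsub Qd Qo Qr]] lr] := inv_level iP (tl _ pP).
      split=> //; last by move=> x; rewrite inE => /predU1P[->/=|/lr//]; lra.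
      exists Q; split=> // x; rewrite inE => /predU1P[->/=|]; [lra|exact: Qr].
    * move=> [p' p'P [-> p'B [W [Wm Wok Wdl WB]]]].
      have B0 : 0 < 2 * plevel p0.
        have := level_cost (inv_level iP (tl _ p'P)).
        have := set_cost_ge0 (psol p'); lra.
      have lv' := inv_level iP (tl _ p'P).
      split=> //=.
      - exact: level_mem lv'.
      - exact: level_sat lv'.
      - by apply: le_trans (level_cost lv') (ltW p'B).
      - exists (map (@ptr R I) W); split.
        + by rewrite size_map; apply: leq_trans Wm (inv_size iP).
        + by move=> _ /mapP[w /Wok[wP _] ->]; apply: (level_mem (inv_level iP wP)).
        + by move=> _ /mapP[w /Wdl ? ->].
        + by rewrite /set_opt -map_comp.
        + move=> x; rewrite inE => /predU1P[->/=|xh Bx]; first by rewrite ltxx.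
          move=> _ /mapP[w /Wok[wP /(_ B0) wB] ->].
          by apply: (level_release (inv_level iP wP)) xh _; apply: lt_trans Bx.
      - move=> x; rewrite inE => /predU1P[->/=|xh Bx]; first by rewrite ltxx.
        by apply: (level_release lv') xh _; apply: lt_trans Bx.
  + by move=> p /memK[p' /tl p'P ->]; apply: (inv_release iP).
  + by move=> p /memK[p' /tl p'P ->]; apply: (inv_deadline iP).
- split; first by rewrite mulr_ge0.
  by rewrite halfB; apply: level_evidence.
- apply: scan_cost sc _; apply: le_trans (level_cost lv0) _; lra.
- split; [exact: (inv_deadline iP p0P)|exact: dl].
- have f0 : feasible (reqs [:: p0]) (psol p0) by rewrite /feasible /= (level_sat lv0).
  have [/= /andP[p0E _] PE] := scan_sat sc f0.
  move=> p pP; have [pE|pK] : E \in sat (treq (ptr p)) \/ ptr p \in map (@ptr R I) K.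
  + by move: pP; rewrite inE => /predU1P[->|/PE//]; left.
  + left; rewrite /serves /= pE dl// !andbT.
    by apply: le_trans (inv_release iP pP) (inv_deadline iP p0P).
  + by right.
Qed.

Lemma service_time P x B K : service gamma P x B K ->
  exists2 p, p \in P & x.1 = deadline (ptr p).
Proof. by case=> {P x B K} p P E K _; exists p; rewrite ?mem_head. Qed.

(** [service_inv] iterated along the plan; [h'] records budgets, which bound the costs of the
    transmissions. The bound by the pending deadlines implies that planned times do not decrease. *)
Lemma planned_inv s h now P snaps plan : inv s h now P -> justified s h ->
  planned gamma P snaps plan ->
  exists h', [/\ justified s (h' ++ h), inv s (h' ++ h) now (cur P snaps),
    sched_cost plan <= \sum_(x <- h') x.1, map snd h' = map fst plan &
    (forall x, x \in plan -> now <= x.1 /\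
       forall p, p \in cur P snaps -> x.1 <= deadline (ptr p)) /\
    (forall p, p \in P -> has (fun x => serves x (ptr p)) plan \/
       ptr p \in map (@ptr R I) (cur P snaps))].
Proof.
move=> iP jh; elim=> {snaps plan} [|snaps plan x B K _ [h' [jh' ih' ch' th' [tm sv]]] sx].
  exists [::]; split=> //; first by rewrite /sched_cost !big_nil.
  by split=> // p pP; right; apply: map_f.
have [iK [B0 ev] cx [nx xdl] sK] := service_inv ih' sx.
exists ((B, x.1) :: h'); split=> //=.
- by rewrite /sched_cost !big_cons lerD.
- by rewrite th'.
split.
- have memK p : p \in K -> exists2 p', p' \in cur P snaps & ptr p = ptr p'.
    case: sx => p1 P1 E1 K1 /scan_subseq sub /(map_f (@ptr R I))/(mem_subseq sub).
    by case/mapP=> p' p'P ->; exists p' => //; rewrite inE p'P orbT.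
  move=> y; rewrite inE => /predU1P[->|/tm[ny ydl]]; split=> // p /memK[p' p'P ->].
    exact: xdl.
  exact: ydl.
- move=> p /sv[svp|/mapP[p' p'P e]]; first by left; rewrite /= svp orbT.
  by rewrite e /=; have [->|?] := sK _ p'P; [left|right].
Qed.

(** Planned times do not decrease, so popping snapshots and filtering the plan by time cut at the
    same place. *)
Lemma popped_planned s h now r P snaps plan : inv s h now P -> justified s h ->
  planned gamma P snaps plan ->
  (forall p, p \in cur P snaps -> r <= deadline (ptr p)) ->
  planned gamma P (popped r snaps) [seq x <- plan | x.1 < r] /\
  (forall p, p \in cur P (popped r snaps) -> r <= deadline (ptr p)).
Proof.
move=> iP jh; elim=> {snaps plan} [|snaps plan x B K pl IH sx].
  by move=> dl; split; first exact: planned_nil.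
move=> dl /=; have [h' [_ ih' _ _ [tm _]]] := planned_inv iP jh pl.
have [rx|xr] := leP r x.1.
  apply: IH => p pP; apply: le_trans rx _.
  by have [_ _ _ [_ xdl] _] := service_inv ih' sx; apply: xdl.
split=> //.
rewrite (_ : [seq _ <- _ | _] = plan); first exact: planned_cons pl sx.
apply/all_filterP/allP => y /tm[_]; have [p pP xp] := service_time sx.
by move=> /(_ _ pP); rewrite -xp => /le_lt_trans; apply.
Qed.

Lemma perm_insert p P : perm_eq (insert p P) (p :: P).
Proof.
elim: P => [|p' P IH] //=; case: ifP => // _.
apply: (@perm_trans _ (p' :: p :: P)); first by rewrite perm_cons.
by apply/permPl; exact: (perm_catCA [:: p'] [:: p] P).
Qed.

Lemma sorted_insert p P : sorted (@by_deadline R I) (map (@ptr R I) P) ->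
  sorted (@by_deadline R I) (map (@ptr R I) (insert p P)).
Proof.
elim: P => [|p' P IH] //= sP; case: ifP => [le|/negbT]; last first.
  by rewrite -ltNge => /ltW le /=; rewrite [by_deadline _ _]le sP.
move: IH sP => /=; case: P => [|p2 P] /= IH; first by rewrite [by_deadline _ _]le.
move=> /andP[p'2 sP]; move: (IH sP).
by case: ifP => /= [_ ->|_ ->]; rewrite ?p'2 ?[by_deadline _ _]le.
Qed.

Lemma inv_later s h now now' P : inv s h now P -> now <= now' ->
  (forall p, p \in P -> now' <= deadline (ptr p)) -> inv s h now' P.
Proof.
move=> [? ? ? rel _] le dl; split=> // p /rel pnow; exact: le_trans pnow le.
Qed.

(** The new request is itself the witness of its initial level, being released after all services so
    far. *)
Lemma insert_inv s h q P E : inv s h (release q) P -> q \in s ->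
  approx_sol gamma [:: treq q] E -> release q <= deadline q ->
  (size P < size s)%N -> (forall x, x \in h -> x.2 < release q) ->
  inv s h (release q) (insert (Pending q (set_cost E) E) P).
Proof.
move=> [sP zP lP rP dP] qs [qE Ele] qd sz hq.
have memI p : p \in insert (Pending q (set_cost E) E) P ->
    p = Pending q (set_cost E) E \/ p \in P.
  by rewrite (perm_mem (perm_insert _ _)) inE => /predU1P.
split.
- exact: sorted_insert.
- by rewrite (perm_size (perm_insert _ _)).
- move=> p /memI[->|/lP//]; split=> //=.
  + by move: qE; rewrite /feasible /= andbT.
  + exists [:: q]; split=> //=.
    * by case: (s) qs.
    * by move=> q'; rewrite inE => /eqP->.
    * by move=> q'; rewrite inE => /eqP->.
    * by move=> x /hq ? _ q'; rewrite inE => /eqP->.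
  + by move=> x /hq.
- by move=> p /memI[->|/rP].
- by move=> p /memI[->|/dP].
Qed.

Lemma planned_subseq P snaps plan : planned gamma P snaps plan ->
  subseq (map (@ptr R I) (cur P snaps)) (map (@ptr R I) P).
Proof.
elim=> {snaps plan} [|snaps plan x B K _ IH sx] //=; apply: subseq_trans IH.
case: sx => {x B K} p P' E K /scan_subseq sub.
exact: subseq_trans sub (subseq_cons _ _).
Qed.

(** One call: roll back, insert the new request, and plan until nothing is pending, as if no request
    followed. *)
Definition call_ok P0 (snaps : seq (R * seq (pending I))) q P1 snaps' plan : Prop :=
  exists E, [/\ approx_sol gamma [:: treq q] E,
    P1 = insert (Pending q (set_cost E) E) (cur P0 (popped (release q) snaps)),
    planned gamma P1 snaps' plan & cur P1 snaps' = [::]].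

Inductive abstract_run : seq (pending I) -> seq (R * seq (pending I)) ->
    seq (timed_request I) -> schedule I -> Prop :=
| abstract_nil P0 snaps : abstract_run P0 snaps [::] [::]
| abstract_cons P0 snaps q s P1 snaps' plan S :
    call_ok P0 snaps q P1 snaps' plan -> abstract_run P1 snaps' s S ->
    abstract_run P0 snaps (q :: s) (until_next q s plan ++ S).

Lemma sched_cost_cat (S S' : schedule I) :
  sched_cost (S ++ S') = sched_cost S + sched_cost S'.
Proof. exact: big_cat. Qed.

(** The history contains only services that take place, and [P] is what is pending at the next
    release. Bounding pending and future requests together by [size s] keeps witnesses within the
    number of requests. *)
Lemma abstract_run_ok s P0 snaps s2 S h P : abstract_run P0 snaps s2 S ->
  online_input s2 -> {subset s2 <= s} -> justified s h ->
  P = (if s2 is q :: _ then cur P0 (popped (release q) snaps) else [::]) ->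
  (size P + size s2 <= size s)%N ->
  (if s2 is q :: _ then inv s h (release q) P /\
     (forall x, x \in h -> x.2 < release q) else True) ->
  exists h', [/\ justified s (h' ++ h), sched_cost S <= \sum_(x <- h') x.1 &
    forall q, q \in map (@ptr R I) P ++ s2 -> has (fun x => serves x q) S].
Proof.
move=> rn; elim: rn h P => {P0 snaps s2 S}.
  move=> P0 snaps h P _ _ jh -> _ _; exists [::]; split=> //.
  by rewrite /sched_cost !big_nil.
move=> P0 snaps q s2 P1 snaps' plan S [E [aE -> pl curE]] _ IH h P.
move=> /andP[srt dls] sub jh eP sz [iP hq].
rewrite -eP in pl curE IH.
set P1' := insert _ _ in pl curE IH.
have qd : release q <= deadline q by have /andP[] := dls.
have qs : q \in s by apply: sub; rewrite mem_head.
have iP1 : inv s h (release q) P1'.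
  apply: insert_inv => //; apply: leq_trans sz; by rewrite /= addnS ltnS leq_addr.
pose plan' := until_next q s2 plan.
have [h1 [jh1 ih1 ch1 th1 [tm1 sv1]]] := planned_inv iP1 jh pl.
have nowx x : x \in plan -> release q <= x.1 by move=> /tm1[].
(* The executed part of the plan: cut at the next release if there is one, and otherwise the whole
   plan, after which nothing is pending. *)
have [snaps2 [P2 [pl2 eP2 dP2 hP2]]] : exists snaps2 P2,
    [/\ planned gamma P1' snaps2 plan', P2 = cur P1' snaps2,
        forall q', q' \in take 1 s2 ->
         (forall p, p \in P2 -> release q' <= deadline (ptr p)) /\
         forall x, x \in plan' -> x.1 < release q' &
        P2 = (if s2 is q :: _ then cur P1' (popped (release q) snaps') else [::])].
  rewrite /plan' /until_next; case: (s2) => [|q' s3].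
    exists snaps', (cur P1' snaps'); split=> //.
    by rewrite (_ : [seq _ <- _ | _] = plan)//; apply/all_filterP/allP => x /nowx ->.
  have [|pl' dl'] := @popped_planned _ _ _ (release q') _ _ _ iP1 jh pl.
    by rewrite curE.
  have e : [seq x <- plan | x.1 < release q'] =
      [seq x <- plan | (release q <= x.1) && (x.1 < release q')].
    by apply: eq_in_filter => x /nowx ->.
  exists (popped (release q') snaps'), (cur P1' (popped (release q') snaps')).
  split=> //; first by rewrite -e.
  move=> q''; rewrite /= take0 inE => /eqP->; split=> //.
  by move=> x; rewrite mem_filter => /andP[/andP[]].
have [h2 [jh2 ih2 ch2 th2 [tm2 sv2]]] := planned_inv iP1 jh pl2.
rewrite -eP2 in ih2 sv2.
have szP2 : (size P2 <= (size P).+1)%N.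
  rewrite eP2; have := size_subseq (planned_subseq pl2); rewrite !size_map.
  by rewrite (perm_size (perm_insert _ _)).
have [||||||h3 [jh3 ch3 sv3]] := IH (h2 ++ h) P2.
- move: srt dls => /= /path_sorted ? /andP[_ ?]; exact/andP.
- by move=> q' q's; apply: sub; rewrite inE q's orbT.
- exact: jh2.
- exact: hP2.
- by apply: leq_trans sz; rewrite /= addnS -addSn leq_add2r.
- case: (s2) srt dP2 => // q' s3 /= /andP[qq' _] /(_ q').
  rewrite take0 mem_head => /(_ isT)[dlq' planq'].
  split; first exact: inv_later ih2 qq' dlq'.
  move=> x; rewrite mem_cat => /orP[xh2|/hq xq]; last exact: lt_le_trans xq qq'.
  have : x.2 \in map snd h2 by apply: map_f.
  by rewrite th2 => /mapP[y /planq' + ->].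
exists (h3 ++ h2); split; first by rewrite -catA.
- by rewrite sched_cost_cat big_cat addrC lerD.
- have svP1 q' : q' \in map (@ptr R I) P1' -> has (fun x => serves x q') (plan' ++ S).
    move=> /mapP[p pP1 ->]; rewrite has_cat.
    have [->//|pP2] := sv2 _ pP1.
    by rewrite sv3 ?orbT// mem_cat pP2.
  move=> q'; rewrite mem_cat inE orbCA => /predU1P[->|/orP[/mapP[p pP ->]|q's]].
  + apply: svP1; apply/mapP; exists (Pending q (set_cost E) E) => //.
    by rewrite (perm_mem (perm_insert _ _)) mem_head.
  + apply: svP1; apply: map_f.
    by rewrite (perm_mem (perm_insert _ _)) inE pP orbT.
  + by rewrite has_cat sv3 ?orbT// mem_cat q's orbT.
Qed.

End Analysis.

(** * Charging the services to an arbitrary offline schedule *)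

Section Competitive.
Variables (R : realType) (I : network R) (gamma : R).
Implicit Types (E : {set elt I}) (q : timed_request I) (B th : R)
  (h : seq (R * R)) (s Q : seq (timed_request I)) (S W : schedule I).

Lemma sum_setU_le (F : elt I -> R) E E' : (forall e, 0 <= F e) ->
  \sum_(e in E :|: E') F e <= \sum_(e in E) F e + \sum_(e in E') F e.
Proof.
move=> F0; rewrite (bigID (mem E)) /= lerD//.
  rewrite le_eqVlt; apply/orP; left; apply/eqP; apply: eq_bigl => e.
  by rewrite inE /=; case: (e \in E) => //=; rewrite andbF.
rewrite [leRHS](bigID (mem E)) /= [leLHS](_ : _ = \sum_(e in E' | e \notin E) F e).
  by rewrite lerDr sumr_ge0.
by apply: eq_bigl => e; rewrite inE; case: (e \in E) => //=; rewrite !andbF.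
Qed.

Lemma sum_bigcup_le (F : elt I -> R) (T : Type) (r : seq T) (P : pred T)
    (A : T -> {set elt I}) : (forall e, 0 <= F e) ->
  \sum_(e in \bigcup_(i <- r | P i) A i) F e <=
  \sum_(i <- r | P i) \sum_(e in A i) F e.
Proof.
move=> F0; elim: r => [|i r IH]; first by rewrite !big_nil big_set0.
rewrite !big_cons; case: (P i) => //.
by apply: le_trans (sum_setU_le _ _ F0) _; rewrite lerD2l.
Qed.

Definition set_items S : seq (R * R) := [seq (x.1, set_cost x.2) | x <- S].

Definition elt_items S : seq (R * R) :=
  [seq (x.1, cost e) | x <- S, e <- enum (x.2 : {set elt I})].

Lemma bigcup_sup_seq W (P : pred (R * {set elt I})) x : x \in W -> P x ->
  x.2 \subset \bigcup_(y <- W | P y) y.2.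
Proof. by move=> xW Px; rewrite (big_rem x xW)/= Px finset.subsetUl. Qed.

(** Take the union of all sets costing more than [th], and one cheap set for each request that needs
    it. *)
Lemma opt_le_sets Q W th : 0 <= th ->
  (forall q, q \in Q -> exists2 x, x \in W & x.2 \in sat (treq q)) ->
  set_opt Q <= (size Q)%:R * th + \sum_(x <- W | th < set_cost x.2) set_cost x.2.
Proof.
move=> th0 QW; pose U := \bigcup_(x <- W | th < set_cost x.2) x.2.
(* Keeping [U] inside [E] makes the requests with an expensive set free in the induction. *)
have [E [QE _ Ele]] : exists E, [/\ feasible [seq treq q | q <- Q] E, U \subset E &
    set_cost E <= (size Q)%:R * th +
      \sum_(x <- W | th < set_cost x.2) set_cost x.2].
  elim: Q QW => [|q Q IH] QW.
    exists U; split=> //; rewrite mul0r add0r.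
    by apply: sum_bigcup_le => e; apply: cost_ge0.
  have [q' q'Q|E [QE UE Ele]] := IH; first by apply: QW; rewrite inE q'Q orbT.
  have [x xW xq] := QW _ (mem_head _ _).
  have [xth|thx] := leP (set_cost x.2) th.
    exists (E :|: x.2); split.
    - rewrite /feasible /= (sat_up xq) ?finset.subsetUr//=.
      by apply: sub_all QE => r rE; apply: sat_up rE _; apply: finset.subsetUl.
    - exact: fintype.subset_trans UE (finset.subsetUl _ _).
    - apply: le_trans (sum_setU_le _ _ (@cost_ge0 _ I)) _.
      rewrite /= -natr1 mulrDl mul1r; move: Ele xth; rewrite /set_cost; lra.
  exists E; split=> //.
    rewrite /feasible /= (sat_up xq)//=.
    exact: fintype.subset_trans (bigcup_sup_seq xW thx) UE.
  by rewrite /= -natr1 mulrDl mul1r; move: Ele; lra.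
exact: le_trans (opt_le QE) Ele.
Qed.

(** In the union of all sets, the elements of cost at most [th] contribute at most [th] each; the
    others are paid wherever they occur. *)
Lemma opt_le_elts Q W th : 0 <= th ->
  (forall q, q \in Q -> exists2 x, x \in W & x.2 \in sat (treq q)) ->
  set_opt Q <= #|elt I|%:R * th +
    \sum_(x <- W) \sum_(e in x.2 | th < cost e) cost e.
Proof.
move=> th0 QW; pose U := \bigcup_(x <- W) x.2.
have QU : feasible [seq treq q | q <- Q] U.
  rewrite /feasible all_map; apply/allP => q /QW[x xW xq] /=.
  by apply: sat_up xq _; rewrite /U; exact: (@bigcup_sup_seq W xpredT).
apply: le_trans (opt_le QU) _; rewrite /set_cost (bigID (fun e => th < cost e)) /= addrC.
apply: lerD.
  apply: (@le_trans _ _ (\sum_(e in elt I) th)).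
    rewrite big_mkcond; apply: ler_sum => e _; case: ifP => // /andP[_].
    by rewrite -leNgt.
  by rewrite sumr_const mulr_natl.
rewrite big_mkcondr /=.
apply: le_trans (sum_bigcup_le _ _ _ _) _.
  by move=> e; case: ifP => // _; apply: cost_ge0.
by apply: ler_sum => x _; rewrite -big_mkcondr.
Qed.

(** Dividing a budget by [2 * gamma] turns it into a lower bound on the optimum of its witness. *)
Definition rescaled h : seq (R * R) := [seq (x.1 / (2 * gamma), x.2) | x <- h].

(** Deadlines of the witness put its offline transmissions no later than [t]; its release times put
    them after every earlier service with budget above [B / 2]. *)
Lemma evidence_window s h B t S : 0 < gamma -> sched_feasible s S ->
  evidence gamma s h (B / 2) (B / 2) t ->
  exists Q, [/\ (size Q <= size s)%N, B / (2 * gamma) <= set_opt Q &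
    forall q, q \in Q -> exists2 x, 
      x \in [seq x <- S | window (B / (2 * gamma), t) (rescaled h) x.1] &
      x.2 \in sat (treq q)].
Proof.
move=> g0 /allP sS [Q [szQ Qs Qt QB Qh]]; exists Q; split=> //.
  by rewrite ler_pdivrMr ?mulr_gt0//; lra.
move=> q qQ; have /hasP[x xS /andP[/andP[rx xd] xq]] := sS _ (Qs _ qQ).
exists x => //; rewrite mem_filter xS andbT /window /= (le_trans xd (Qt _ qQ)) /=.
apply/allP => _ /mapP[y yh ->] /=; apply/implyP.
rewrite mulrA ltr_pM2r ?invr_gt0 ?mulr_gt0// => By.
by apply: lt_le_trans rx; apply: (Qh y) => //; lra.
Qed.

Lemma covered_sets s h S : 0 < gamma -> sched_feasible s S ->
  justified gamma s h -> covered (size s) (set_items S) (rescaled h).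
Proof.
move=> g0 sS; elim: h => [|x h IH] //= [[x0 ev] jh]; split; last exact: IH.
split=> [|th th0]; first by rewrite divr_ge0// mulr_ge0// ltW.
have [Q [szQ BQ Qx]] := evidence_window g0 sS ev.
apply: le_trans BQ _; apply: le_trans (opt_le_sets th0 Qx) _.
rewrite big_filter_cond big_map lerD2r.
by rewrite ler_wpM2r// ler_nat.
Qed.

Lemma covered_elts s h S : 0 < gamma -> sched_feasible s S ->
  justified gamma s h -> covered #|elt I| (elt_items S) (rescaled h).
Proof.
move=> g0 sS; elim: h => [|x h IH] //= [[x0 ev] jh]; split; last exact: IH.
split=> [|th th0]; first by rewrite divr_ge0// mulr_ge0// ltW.
have [Q [szQ BQ Qx]] := evidence_window g0 sS ev.
apply: le_trans BQ _; apply: le_trans (opt_le_elts th0 Qx) _.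
rewrite lerD2l big_filter big_mkcond [leRHS]big_mkcond big_allpairs_dep /=.
apply: ler_sum => y _ /=; case: ifP => _ /=.
  by rewrite -big_mkcond big_enum_cond.
by rewrite big1.
Qed.

(** Items are whole transmissions if requests are fewer than elements, and single elements
    otherwise; both add up to the cost of [S]. Undoing the rescaling gives [36 = 2 * 18]. *)
Lemma justified_le s h S : 0 < gamma -> sched_feasible s S -> justified gamma s h ->
  \sum_(x <- h) x.1 <=
  36 * gamma * (1 + ln (minn (size s) #|elt I|)%:R) * sched_cost S.
Proof.
move=> g0 sS jh.
have -> : \sum_(x <- h) x.1 = 2 * gamma * \sum_(x <- rescaled h) x.1.
  rewrite big_map mulr_sumr; apply: eq_bigr => x _.
  by rewrite /= mulrC mulfVK// mulf_neq0// ?pnatr_eq0// lt0r_neq0.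
have -> (l : R) : 36 * gamma * l * sched_cost S =
  2 * gamma * (18 * l * sched_cost S) by ring.
rewrite ler_pM2l ?mulr_gt0//.
rewrite /minn; case: ifP => _.
  have := sum_covered_le_ln (covered_sets g0 sS jh).
  have -> : \sum_(it <- set_items S) it.2 = sched_cost S by rewrite big_map.
  apply=> _ /mapP[x _ ->]; exact: set_cost_ge0.
have := sum_covered_le_ln (covered_elts g0 sS jh).
have -> : \sum_(it <- elt_items S) it.2 = sched_cost S.
  by rewrite big_allpairs_dep; apply: eq_bigr => x _; rewrite big_enum.
apply=> _ /allpairsPdep[x [e [_ _ ->]]]; exact: cost_ge0.
Qed.

End Competitive.

(** * Program logic *)

Section MoreCoins.
Variable R : realType.

Lemma terminates_map A B (X : seq bool -> A -> Prop) (g : A -> B)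
    (Y : seq bool -> B -> Prop) tmX tmY (k : nat) (Q : B -> Prop) b :
  unambiguous X -> (forall w r, Y w r <-> exists2 a, X w a & r = g a) ->
  (forall a, tmY (g a) = tmX a + k)%N ->
  terminates R X tmX (fun a => Q (g a)) b -> terminates R Y tmY Q (b + k).
Proof.
move=> uX defY tmE Xb.
have [] := @terminates_bind R A unit B X (fun _ w _ => w = [::]) (fun a _ => g a) Y
  tmX (fun=> 0%N) tmY k (fun a => Q (g a)) Q b 0 uX _ _ _ Xb _.
- by move=> _ w u [] [] -> /= ->.
- move=> w c; split=> [/defY[a Xa ->]|[w1 [w2 [a [_ [-> Xa -> ->]]]]]].
    by exists w, [::], a, tt; rewrite cats0.
  by apply/defY; exists a; rewrite ?cats0.
- by move=> a _; rewrite tmE addn0.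
- move=> a Qa; apply: (@terminates_ret _ _ _ _ _ _ tt) => // w [].
  by split=> [->|[]].
- by rewrite addn0; split.
Qed.

End MoreCoins.

Section ProgramLogic.
Variable R : realType.
Local Notation data := (data R).
Local Notation store := (store R).
Implicit Types (s low m : store) (c : cmd) (Q : store -> Prop).

Lemma exec_seq_inv c1 c2 s w s' t : exec (Seq c1 c2) s w s' t ->
  exists w1 s1 t1 w2 t2, [/\ w = w1 ++ w2, t = (t1 + t2)%N, exec c1 s w1 s1 t1 &
    exec c2 s1 w2 s' t2].
Proof. by move=> H; inversion H; subst; do 5 eexists; split; eauto. Qed.

Lemma exec_if_inv e c1 c2 s w s' t : exec (If e c1 c2) s w s' t ->
  exists2 t1, t = t1.+1 & exec (if truthy (eval s e) then c1 else c2) s w s' t1.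
Proof.
move=> H; inversion H; subst; eexists; eauto.
  by rewrite (_ : truthy _ = true).
by rewrite (_ : truthy _ = false)//; apply: negbTE.
Qed.

Lemma exec_while_inv e c s w s' t : exec (While e c) s w s' t ->
  if truthy (eval s e) then
    exists w1 s1 t1 w2 t2, [/\ w = w1 ++ w2, t = (t1 + t2).+1, exec c s w1 s1 t1 &
      exec (While e c) s1 w2 s' t2]
  else [/\ w = [::], s' = s & t = 1%N].
Proof.
move=> H; inversion H; subst.
  by rewrite (_ : truthy _ = false)//; apply: negbTE.
by rewrite (_ : truthy _ = true)//; do 5 eexists; split; eauto.
Qed.

(** Arbitrary continuations [u] and [u'] let the induction pass through compositions and loops,
    where two runs could split the coins differently. *)
Lemma exec_unambiguous_cat c s w s1 t1 : exec c s w s1 t1 ->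
  forall w' s2 t2 u u', exec c s w' s2 t2 -> w ++ u = w' ++ u' ->
  [/\ w = w', s1 = s2 & t1 = t2].
Proof.
have cat_inj (v u u' : seq bool) : v ++ u = v ++ u' -> u = u'.
  by move=> /eqP; rewrite eqseq_cat// => /andP[_ /eqP].
elim=> {c s w s1 t1}.
- by move=> s w' s2 t2 u u' H; inversion H; subst.
- by move=> x e s w' s2 t2 u u' H; inversion H; subst.
- by move=> x b s w' s2 t2 u u' H; inversion H; subst => -[->].
- move=> c1 c2 s w1 s1 t1 w2 s2 t2 _ IH1 _ IH2 w' s' t' u u'.
  move=> /exec_seq_inv[v1 [s3 [t3 [v2 [t4 [-> -> H1 H2]]]]]]; rewrite -!catA => e.
  have [? ? ?] := IH1 _ _ _ _ _ H1 e; subst.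
  by have [-> -> ->] := IH2 _ _ _ _ _ H2 (cat_inj _ _ _ e).
- move=> e c1 c2 s w s1 t es _ IH w' s' t' u u' /exec_if_inv[t1 ->].
  by rewrite es => H E; have [-> -> ->] := IH _ _ _ _ _ H E.
- move=> e c1 c2 s w s1 t /negbTE es _ IH w' s' t' u u' /exec_if_inv[t1 ->].
  by rewrite es => H E; have [-> -> ->] := IH _ _ _ _ _ H E.
- move=> e c s /negbTE es w' s' t' u u' /exec_while_inv.
  by rewrite es => -[-> -> ->].
- move=> e c s w1 s1 t1 w2 s2 t2 es _ IH1 _ IH2 w' s' t' u u' /exec_while_inv.
  rewrite es => -[v1 [s3 [t3 [v2 [t4 [-> -> H1 H2]]]]]]; rewrite -!catA => E.
  have [? ? ?] := IH1 _ _ _ _ _ H1 E; subst.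
  by have [-> -> ->] := IH2 _ _ _ _ _ H2 (cat_inj _ _ _ E).
Qed.

Definition outcome c s : seq bool -> store * nat -> Prop :=
  fun w r => exec c s w r.1 r.2.

Lemma outcome_unambiguous c s : unambiguous (outcome c s).
Proof.
move=> w u [s1 t1] [s2 t2]; rewrite /outcome /= => H1 H2.
have [e -> ->] := exec_unambiguous_cat (u := u) (u' := [::]) H1 H2 (esym (cats0 _)).
split=> //; move: (congr1 size e); rewrite size_cat.
by case: u {H2 e} => //= b u /eqP; rewrite -[X in X == _]addn0 eqn_add2l.
Qed.

Definition triple c s Q b : Prop :=
  terminates R (outcome c s) snd (fun r => Q r.1) b.

Lemma triple_sub c s Q Q' b b' : triple c s Q b ->
  (forall s', Q s' -> Q' s') -> (b <= b')%N -> triple c s Q' b'.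
Proof. by move=> cb QQ' bb'; apply: terminates_sub cb _ bb' => -[s' t] /= /QQ'. Qed.

Lemma triple_skip s Q : Q s -> triple Skip s Q 1.
Proof.
move=> Qs; apply: (@terminates_ret _ _ _ _ _ _ (s, 1%N)) => // w [s' t] /=.
split=> [H|[-> [-> ->]]]; last exact: exec_skip.
by rewrite /outcome /= in H; inversion H; subst.
Qed.

Lemma triple_assign x e s Q : Q (upd s x (eval s e)) -> triple (Assign x e) s Q 1.
Proof.
move=> Qs; apply: (@terminates_ret _ _ _ _ _ _ (upd s x (eval s e), 1%N)) => //.
move=> w [s' t] /=; split=> [H|[-> [-> ->]]]; last exact: exec_assign.
by rewrite /outcome /= in H; inversion H; subst.
Qed.

Lemma triple_seq c1 c2 s P Q b1 b2 : triple c1 s P b1 ->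
  (forall s', P s' -> triple c2 s' Q b2) -> triple (Seq c1 c2) s Q (b1 + b2).
Proof.
move=> H1 H2; rewrite -[(b1 + b2)%N]addn0.
apply: (@terminates_bind _ _ _ _ _ (fun r => outcome c2 r.1)
  (fun r r' => (r'.1, r.2 + r'.2)%N) _ _ snd _ _ _ _ _ _ _ _ _ _ H1).
- exact: outcome_unambiguous.
- by move=> a; exact: outcome_unambiguous.
- move=> w [s2 t]; split=> [H|].
    have [w1 [s1 [t1 [w2 [t2 [-> /= -> H3 H4]]]]]] := exec_seq_inv H.
    by exists w1, w2, (s1, t1), (s2, t2).
  move=> [w1 [w2 [[s1 t1] [[s3 t2] [-> /= H3 H4 [-> ->]]]]]].
  exact: exec_seq H3 H4.
- by move=> a b; rewrite addn0.
- by move=> [s1 t1] /H2.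
Qed.

Lemma triple_if e c1 c2 s Q b :
  (truthy (eval s e) -> triple c1 s Q b) ->
  (~~ truthy (eval s e) -> triple c2 s Q b) -> triple (If e c1 c2) s Q b.+1.
Proof.
have [es|es] := boolP (truthy (eval s e)) => H1 H2; rewrite -addn1.
  apply: (@terminates_map _ _ _ _ (fun r => (r.1, r.2.+1)) _ _ _ _ _ _ _ _ _ (H1 isT)).
  - exact: outcome_unambiguous.
  - move=> w [s' t]; split=> [H|[[s1 t1] H [-> ->]]]; last exact: exec_if_true.
    have [t1 /= ->] := exec_if_inv H; rewrite es.
    by exists (s', t1).
  - by move=> a; rewrite addn1.
apply: (@terminates_map _ _ _ _ (fun r => (r.1, r.2.+1)) _ _ _ _ _ _ _ _ _ (H2 isT)).
- exact: outcome_unambiguous.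
- move=> w [s' t]; split=> [H|[[s1 t1] H [-> ->]]]; last exact: exec_if_false.
  have [t1 /= ->] := exec_if_inv H; rewrite (negbTE es).
  by exists (s', t1).
- by move=> a; rewrite addn1.
Qed.

(** A single unrolling: loops are treated by induction on the lists that they consume. *)
Lemma triple_while_true e c s P Q b1 b2 : truthy (eval s e) -> triple c s P b1 ->
  (forall s', P s' -> triple (While e c) s' Q b2) ->
  triple (While e c) s Q (b1 + b2 + 1).
Proof.
move=> es H1 H2.
apply: (@terminates_bind _ _ _ _ _ (fun r => outcome (While e c) r.1)
  (fun r r' => (r'.1, (r.2 + r'.2).+1)) _ _ snd _ _ _ _ _ _ _ _ _ _ H1).
- exact: outcome_unambiguous.
- by move=> a; exact: outcome_unambiguous.
- move=> w [s2 t]; split=> [H|].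
    have := exec_while_inv H; rewrite es => -[w1 [s1 [t1 [w2 [t2 [-> /= -> H3 H4]]]]]].
    by exists w1, w2, (s1, t1), (s2, t2).
  move=> [w1 [w2 [[s1 t1] [[s3 t2] [-> /= H3 H4 [-> ->]]]]]].
  exact: exec_while_true H3 H4.
- by move=> a b; rewrite addn1.
- by move=> [s1 t1] /H2.
Qed.

Lemma triple_while_false e c s Q : ~~ truthy (eval s e) -> Q s ->
  triple (While e c) s Q 1.
Proof.
move=> es Qs; apply: (@terminates_ret _ _ _ _ _ _ (s, 1%N)) => // w [s' t] /=.
split=> [H|[-> [-> ->]]]; last exact: exec_while_false.
by have := exec_while_inv H; rewrite (negbTE es) => -[-> /= -> ->].
Qed.

End ProgramLogic.

(** * Embedding the offline program into a separate block of registers *)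

Fixpoint shift_expr k e : expr :=
  match e with
  | EVar x => EVar (k + x)
  | ENull => ENull
  | ELit n => ELit n
  | EPair e1 e2 => EPair (shift_expr k e1) (shift_expr k e2)
  | EFst e1 => EFst (shift_expr k e1)
  | ESnd e1 => ESnd (shift_expr k e1)
  | EIsNum e1 => EIsNum (shift_expr k e1)
  | EIsPair e1 => EIsPair (shift_expr k e1)
  | EAdd e1 e2 => EAdd (shift_expr k e1) (shift_expr k e2)
  | ESub e1 e2 => ESub (shift_expr k e1) (shift_expr k e2)
  | EMul e1 e2 => EMul (shift_expr k e1) (shift_expr k e2)
  | EDiv e1 e2 => EDiv (shift_expr k e1) (shift_expr k e2)
  | ELe e1 e2 => ELe (shift_expr k e1) (shift_expr k e2)
  end.

Fixpoint shift k c : cmd :=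
  match c with
  | Skip => Skip
  | Assign x e => Assign (k + x) (shift_expr k e)
  | Flip x => Flip (k + x)
  | Seq c1 c2 => Seq (shift k c1) (shift k c2)
  | If e c1 c2 => If (shift_expr k e) (shift k c1) (shift k c2)
  | While e c1 => While (shift_expr k e) (shift k c1)
  end.

(** [Skip] counts for 1, so that the input variable 0 is always included. *)
Fixpoint assigned c : nat :=
  match c with
  | Skip => 1
  | Assign x _ | Flip x => x.+1
  | Seq c1 c2 | If _ c1 c2 => maxn (assigned c1) (assigned c2)
  | While _ c1 => assigned c1
  end.

Lemma assigned_gt0 c : (0 < assigned c)%N.
Proof. by elim: c => //= [c1 h c2 _|e c1 h c2 _]; apply: leq_trans h (leq_maxl _ _). Qed.

Fixpoint vars_below k e : bool :=
  match e with
  | EVar x => (x < k)%N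
  | ENull | ELit _ => true
  | EFst e1 | ESnd e1 | EIsNum e1 | EIsPair e1 => vars_below k e1
  | EPair e1 e2 | EAdd e1 e2 | ESub e1 e2 | EMul e1 e2 | EDiv e1 e2 | ELe e1 e2 =>
      vars_below k e1 && vars_below k e2
  end.

(** The offline program is specified from a store that is [Null] outside its input, so its registers
    are reset before each call. *)
Fixpoint clear k n : cmd :=
  if n is n'.+1 then Seq (Assign (k + n') ENull) (clear k n') else Skip.

Lemma coin_free_shift k c : coin_free (shift k c) = coin_free c.
Proof. by elim: c => //= [c1 -> c2 ->|_ c1 -> c2 ->]. Qed.

Lemma coin_free_clear k n : coin_free (clear k n).
Proof. by elim: n. Qed.

Section Registers.
Variables (R : realType) (k : nat).
Local Notation data := (data R).
Local Notation store := (store R).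
Implicit Types (s low m : store) (c : cmd) (Q : store -> Prop).

Definition join low m : store := fun x => if (x < k)%N then low x else m (x - k)%N.

Lemma upd_join_low low m x d : (x < k)%N ->
  upd (join low m) x d = join (upd low x d) m.
Proof.
move=> xk; apply/funext => y; rewrite /upd /join.
by case: eqVneq => [->|//]; rewrite xk.
Qed.

Lemma upd_join_high low m x d : upd (join low m) (k + x) d = join low (upd m x d).
Proof.
apply/funext => y; rewrite /upd /join; case: ltnP => ky.
  by case: eqVneq ky => // ->; rewrite ltnNge leq_addr.
by rewrite -(eqn_add2l k (y - k)) subnKC.
Qed.

Lemma eval_join_low low m e : vars_below k e -> eval (join low m) e = eval low e.
Proof.
elim: e => //=.
- by move=> x xk; rewrite /join xk.
all: try by move=> e1 IH1 e2 IH2 /andP[/IH1 -> /IH2 ->].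
all: by move=> e IH /IH ->.
Qed.

Lemma eval_shift low m e : eval (join low m) (shift_expr k e) = eval m e.
Proof.
elim: e => //=.
- by move=> x; rewrite /join ltnNge leq_addr /= addKn.
all: try by move=> e1 -> e2 ->.
all: by move=> e ->.
Qed.

Lemma exec_shift c low m w m' t : exec c m w m' t ->
  exec (shift k c) (join low m) w (join low m') t.
Proof.
elim=> {c m w m' t} /=.
- by move=> s; exact: exec_skip.
- move=> x e s; rewrite -upd_join_high -(eval_shift low); exact: exec_assign.
- by move=> x b s; rewrite -upd_join_high; exact: exec_flip.
- by move=> *; apply: exec_seq; eassumption.
- by move=> *; apply: exec_if_true; rewrite ?eval_shift.
- by move=> *; apply: exec_if_false; rewrite ?eval_shift.
- by move=> *; apply: exec_while_false; rewrite ?eval_shift.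
- by move=> *; apply: exec_while_true; rewrite ?eval_shift; eassumption.
Qed.

(** Expectations sum over all runs, so the shifted program must have no runs beyond those given by
    [exec_shift]. *)
Lemma exec_shift_inv c low m w s t : exec (shift k c) (join low m) w s t ->
  exists2 m', exec c m w m' t & s = join low m'.
Proof.
move E : (shift k c) => c'; move E2 : (join low m) => s0 H.
elim: H c m E E2 => {c' s0 w s t}.
- move=> s [] //= m _ <-; exists m => //; exact: exec_skip.
- move=> x e s [] //= y e' m [<- <-] <-; rewrite upd_join_high eval_shift.
  by eexists; last reflexivity; exact: exec_assign.
- move=> x b s [] //= y m [<-] <-; rewrite upd_join_high.
  by eexists; last reflexivity; exact: exec_flip.
- move=> c1 c2 s w1 s1 t1 w2 s2 t2 _ IH1 _ IH2 [] //= c1' c2' m [e1 e2] e3.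
  have [m1 H1 E1] := IH1 _ _ e1 e3.
  have [m2 H2 E2] := IH2 _ _ e2 (esym E1).
  by exists m2 => //; exact: exec_seq H1 H2.
- move=> e c1 c2 s w s' t es _ IH [] //= e' c1' c2' m [e0 e1 e2] e3.
  have [m1 H1 E1] := IH _ _ e1 e3.
  exists m1 => //; apply: exec_if_true => //.
  by rewrite -(eval_shift low) e0 e3.
- move=> e c1 c2 s w s' t es _ IH [] //= e' c1' c2' m [e0 e1 e2] e3.
  have [m1 H1 E1] := IH _ _ e2 e3.
  exists m1 => //; apply: exec_if_false => //.
  by rewrite -(eval_shift low) e0 e3.
- move=> e c s es [] //= e' c' m [e0 e1] e3.
  exists m => //; apply: exec_while_false.
  by rewrite -(eval_shift low) e0 e3.
- move=> e c s w1 s1 t1 w2 s2 t2 es _ IH1 _ IH2 [] //= e' c' m [e0 e1] e3.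
  have [m1 H1 E1] := IH1 _ _ e1 e3.
  have [m2 H2 E2] := IH2 (While e' c') _ (congr2 While e0 e1) (esym E1).
  exists m2 => //; apply: exec_while_true H1 H2.
  by rewrite -(eval_shift low) e0 e3.
Qed.

Lemma exec_unassigned c m w m' t x : exec c m w m' t -> (assigned c <= x)%N ->
  m' x = m x.
Proof.
elim=> {c m w m' t} //=.
- by move=> y e s yx; rewrite /upd gtn_eqF.
- by move=> y e s yx; rewrite /upd gtn_eqF.
- move=> c1 c2 s w1 s1 t1 w2 s2 t2 _ IH1 _ IH2; rewrite geq_max => /andP[/IH1 <- /IH2].
  by [].
- by move=> e c1 c2 s w1 s1 t1 _ _ IH; rewrite geq_max => /andP[/IH].
- by move=> e c1 c2 s w1 s1 t1 _ _ IH; rewrite geq_max => /andP[_ /IH].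
- by move=> e c s w1 s1 t1 w2 s2 t2 _ _ IH1 _ IH2 h; rewrite IH2 ?IH1.
Qed.

Lemma triple_shift c low m Q b : triple c m (fun m' => Q (join low m')) b ->
  triple (shift k c) (join low m) Q b.
Proof.
move=> H; rewrite -[b]addn0.
apply: (@terminates_map _ _ _ _ (fun r => (join low r.1, r.2)) _ _ _ _ _ _ _ _ _ H).
- exact: outcome_unambiguous.
- move=> w [s t]; split=> [/exec_shift_inv[m' H' /= ->]|[[m' t'] H' [-> ->]]].
    by exists (m', t).
  exact: exec_shift.
- by move=> a; rewrite addn0.
Qed.

Lemma triple_clear n low m :
  triple (clear k n) (join low m)
    (fun s => s = join low (fun x => if (x < n)%N then Null else m x)) n.+1.
Proof.
elim: n m => [|n IH] m /=; first by apply: triple_skip; congr join.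
rewrite -[n.+2]add1n; apply: (triple_seq (P := fun s => s = join low (upd m n Null))).
  by apply: triple_assign; rewrite upd_join_high.
move=> _ ->; apply: triple_sub (IH _) _ (leqnn _) => _ ->.
congr join; apply/funext => x; rewrite /upd ltnS [in RHS]leq_eqVlt.
by case: eqVneq => [->|_] //=; rewrite ltnn.
Qed.

End Registers.

(** * The online program *)

Local Notation "c1 ;; c2" := (Seq c1 c2) (at level 80, right associativity).

(** * Program logic for stores given by a list of registers *)

Section RegisterLogic.
Variables (R : realType) (n : nat).
Local Notation data := (data R).
Local Notation store := (store R).
Implicit Types (l : seq data) (m : store) (Q : seq data -> Prop).

(** With [n = assigned c], these are the registers that the offline program never writes and [clear]
    does not reset. *)
Definition clean m : Prop := forall x, (n <= x)%N -> m x = Null.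

Definition regs l m : store := join nreg (nth Null l) m.

Definition spec c l Q b : Prop := forall m, clean m ->
  triple c (regs l m) (fun s => exists l' m', [/\ s = regs l' m', clean m' & Q l']) b.

Lemma spec_le c l Q b b' : spec c l Q b -> (b <= b')%N -> spec c l Q b'.
Proof. by move=> H bb' m cm; exact: triple_sub (H m cm) _ bb'. Qed.

Lemma spec_sub c l Q Q' b : spec c l Q b -> (forall l', Q l' -> Q' l') ->
  spec c l Q' b.
Proof.
move=> H QQ' m /H /triple_sub; apply=> // _ [l' [m' [-> cm /QQ' Ql]]].
by exists l', m'.
Qed.

Lemma regs_upd l m x d : (x < nreg)%N ->
  upd (regs l m) x d = regs (set_nth Null l x d) m.
Proof.
move=> xk; rewrite /regs upd_join_low//; congr join; apply/funext => y.
by rewrite nth_set_nth.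
Qed.

Lemma spec_assign x e l Q : (x < nreg)%N -> vars_below nreg e ->
  Q (set_nth Null l x (eval (nth Null l) e)) -> spec (Assign x e) l Q 1.
Proof.
move=> xk ek Ql m cm; apply: triple_assign.
by rewrite regs_upd// /regs eval_join_low//; do 2 eexists; split.
Qed.

Lemma spec_seq c1 c2 l P Q b1 b2 : spec c1 l P b1 ->
  (forall l', P l' -> spec c2 l' Q b2) -> spec (c1 ;; c2) l Q (b1 + b2).
Proof.
move=> H1 H2 m cm; apply: triple_seq (H1 _ cm) _ => _ [l' [m' [-> cm' Pl]]].
exact: H2.
Qed.

Lemma spec_let x e c l Q b : (x < nreg)%N -> vars_below nreg e ->
  spec c (set_nth Null l x (eval (nth Null l) e)) Q b ->
  spec (Assign x e ;; c) l Q b.+1.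
Proof.
move=> xk ek H; rewrite -add1n.
apply: (spec_seq (P := eq (set_nth Null l x (eval (nth Null l) e)))).
  exact: spec_assign.
by move=> _ <-.
Qed.

Lemma spec_if e c1 c2 l Q b1 b2 : vars_below nreg e ->
  (truthy (eval (nth Null l) e) -> spec c1 l Q b1) ->
  (~~ truthy (eval (nth Null l) e) -> spec c2 l Q b2) ->
  spec (If e c1 c2) l Q (maxn b1 b2).+1.
Proof.
move=> ek H1 H2 m cm; apply: triple_if; rewrite eval_join_low// => /[dup] h.
  by move=> /H1/(_ _ cm)/triple_sub; apply=> //; apply: leq_maxl.
by move=> /H2/(_ _ cm)/triple_sub; apply=> //; apply: leq_maxr.
Qed.

Lemma spec_if_true e c1 c2 l Q b : vars_below nreg e ->
  truthy (eval (nth Null l) e) -> spec c1 l Q b -> spec (If e c1 c2) l Q b.+1.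
Proof. by move=> ek el H; rewrite -(maxn0 b); apply: spec_if => //; rewrite el. Qed.

Lemma spec_if_false e c1 c2 l Q b : vars_below nreg e ->
  ~~ truthy (eval (nth Null l) e) -> spec c2 l Q b -> spec (If e c1 c2) l Q b.+1.
Proof. by move=> ek /negbTE el H; rewrite -(max0n b); apply: spec_if => //; rewrite el. Qed.

Lemma spec_while_true e c l P Q b1 b2 : vars_below nreg e ->
  truthy (eval (nth Null l) e) -> spec c l P b1 ->
  (forall l', P l' -> spec (While e c) l' Q b2) ->
  spec (While e c) l Q (b1 + b2 + 1).
Proof.
move=> ek el H1 H2 m cm; apply: triple_while_true (H1 _ cm) _.
  by rewrite eval_join_low.
by move=> _ [l' [m' [-> cm' Pl]]]; apply: H2.
Qed.

Lemma spec_while_false e c l Q : vars_below nreg e ->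
  ~~ truthy (eval (nth Null l) e) -> Q l -> spec (While e c) l Q 1.
Proof.
move=> ek el Ql m cm; apply: triple_while_false; first by rewrite eval_join_low.
by exists l, m.
Qed.

End RegisterLogic.

(** The registers of the online program:
    0 input and output, 1 network, 2 snapshots, 3 pending requests still to be
    examined, 4 plan, 5 new or expiring request, 6 examined requests (reversed),
    7 budget, 8 offline instance, 9 offline solution, 10 its cost, 11-12 scratch,
    13 set to be transmitted, 14 codes of the served requests, 15 whether the
    budget is exceeded, 16 request under examination. *)
Section Program.
Variable c : cmd.

Definition call_offline : cmd :=
  clear nreg (assigned c) ;; Assign nreg (EPair (EVar 1) (EVar 8)) ;;
  shift nreg c ;; Assign 9 (EVar nreg).

Definition cost_loop : cmd :=
  While (EVar 11)
    (If (EFst (EVar 12)) (Assign 10 (EAdd (EVar 10) (EFst (EVar 11)))) Skip ;;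
     Assign 11 (ESnd (EVar 11)) ;;
     Assign 12 (ESnd (EVar 12))).

Definition solve : cmd :=
  call_offline ;; Assign 10 (ELit 0) ;; Assign 11 (EFst (EVar 1)) ;;
  Assign 12 (EVar 9) ;; cost_loop.

Definition code_of e := EFst e.
Definition deadline_of e := EFst (ESnd e).
Definition level_of e := EFst (ESnd (ESnd e)).
Definition sol_of e := ESnd (ESnd (ESnd e)).

Definition keep (e : expr) : cmd := Assign 6 (EPair e (EVar 6)).

Definition raised : expr :=
  EPair (code_of (EVar 16)) (EPair (deadline_of (EVar 16))
    (EPair (EVar 7) (sol_of (EVar 16)))).

Definition unwind_loop : cmd :=
  While (EVar 6)
    (Assign 3 (EPair (EFst (EVar 6)) (EVar 3)) ;; Assign 6 (ESnd (EVar 6))).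

Definition scan_loop : cmd :=
  While (EVar 3)
    (Assign 16 (EFst (EVar 3)) ;; Assign 3 (ESnd (EVar 3)) ;;
     If (ELe (EVar 7) (level_of (EVar 16))) (keep (EVar 16))
       (If (EVar 15) (keep raised)
          (Assign 8 (EPair (code_of (EVar 16)) (EVar 14)) ;; solve ;;
           If (ELe (EVar 10) (EVar 7))
             (Assign 14 (EVar 8) ;; Assign 13 (EVar 9))
             (Assign 15 (ELit 1) ;; keep raised)))).

Definition service_loop : cmd :=
  While (EVar 3)
    (Assign 5 (EFst (EVar 3)) ;; Assign 3 (ESnd (EVar 3)) ;;
     Assign 7 (EAdd (level_of (EVar 5)) (level_of (EVar 5))) ;;
     Assign 13 (sol_of (EVar 5)) ;;
     Assign 14 (EPair (code_of (EVar 5)) ENull) ;;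
     Assign 15 ENull ;; Assign 6 ENull ;;
     scan_loop ;; unwind_loop ;;
     Assign 4 (EPair (EPair (deadline_of (EVar 5)) (EVar 13)) (EVar 4)) ;;
     Assign 2 (EPair (EPair (deadline_of (EVar 5)) (EVar 3)) (EVar 2))).

(** Comparison with [Null] counts as false: the loop stops at the bottom snapshot, whose time is
    [Null], and at once in the first call, where the state is [Null]. *)
Definition pop_loop : cmd :=
  While (ELe (deadline_of (EVar 5)) (EFst (EFst (EVar 2))))
    (Assign 2 (ESnd (EVar 2))).

Definition insert_loop : cmd :=
  While (ELe (deadline_of (EFst (EVar 3))) (deadline_of (EVar 5)))
    (keep (EFst (EVar 3)) ;; Assign 3 (ESnd (EVar 3))).

(* In a timed request the release time is where pending requests have their
   deadline. *)
Definition online : cmd :=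
  Assign 1 (EFst (EVar 0)) ;; Assign 2 (EFst (ESnd (EVar 0))) ;;
  Assign 5 (ESnd (ESnd (EVar 0))) ;;
  pop_loop ;;
  Assign 3 (ESnd (EFst (EVar 2))) ;;
  Assign 8 (EPair (code_of (EVar 5)) ENull) ;; solve ;;
  Assign 5 (EPair (code_of (EVar 5)) (EPair (ESnd (ESnd (EVar 5)))
    (EPair (EVar 10) (EVar 9)))) ;;
  insert_loop ;;
  Assign 3 (EPair (EVar 5) (EVar 3)) ;; unwind_loop ;;
  Assign 2 (EPair (EPair ENull (EVar 3)) ENull) ;;
  service_loop ;;
  Assign 0 (EPair (EVar 2) (EVar 4)).

Lemma coin_free_online : coin_free c -> coin_free online.
Proof. by move=> h; rewrite /= coin_free_shift coin_free_clear h. Qed.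

End Program.

(** * The online program follows the abstract algorithm *)

Section Specs.
Variables (R : realType) (I : network R) (gamma : R) (c : cmd).
Local Notation data := (data R).
Implicit Types (d : data) (p : pending I) (P : seq (pending I)) (E : {set elt I}).

Definition enc_pending p : data :=
  Pair (nd_code (treq (ptr p))) (Pair (Leaf (deadline (ptr p)))
    (Pair (Leaf (plevel p)) (enc_set R (psol p)))).

Definition enc_pendings P : data := enc_list [seq enc_pending p | p <- P].

Definition enc_snaps P (snaps : seq (R * seq (pending I))) : data :=
  enc_list ([seq Pair (Leaf y.1) (enc_pendings y.2) | y <- snaps] ++
            [:: Pair Null (enc_pendings P)]).

Definition enc_codes (Q : seq (request I)) : data := enc_list [seq nd_code q | q <- Q].

Local Notation spec := (spec (assigned c)).

Definition solves (Q : seq (request I)) b : Prop :=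
  triple c (upd (fun=> Null) 0 (enc_offline Q))
    (fun s => exists2 E, s 0%N = enc_set R E & approx_sol gamma Q E) b.

Ltac step := first
  [ eapply spec_let; [by []|by []|]; rewrite /= ?/arith /=
  | eapply spec_assign; [by []|by []|]; rewrite /= ?/arith /= ].

Lemma call_offline_spec Q b l : solves Q b ->
  nth Null l 1 = enc_network I -> nth Null l 8 = enc_codes Q ->
  spec (call_offline c) l
    (fun l' => exists2 E, approx_sol gamma Q E & l' = set_nth Null l 9 (enc_set R E))
    (assigned c + b + 3).
Proof.
move=> sQ l1 l8 m cm; rewrite (_ : _ + _ + 3 = (assigned c).+1 + (1 + (b + 1)))%N; last by lia.
apply: triple_seq (triple_clear _ _ _ _) _ => _ ->.
(* Clearing and loading the input produce exactly the initial store of [solves]. *)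
apply: (triple_seq (P := fun s => s = regs l (upd (fun=> Null) 0 (enc_offline Q)))).
  apply: triple_assign; rewrite -[X in upd _ X _](addn0 nreg) upd_join_high.
  rewrite /regs; congr join; rewrite /= /join /= l1 l8; congr upd.
  by apply/funext => x; case: ltnP => // /cm.
move=> _ ->; apply: (triple_seq (P := fun s => exists m' E,
    [/\ s = regs l m', clean (assigned c) m',
    m' 0%N = enc_set R E & approx_sol gamma Q E])).
  apply: triple_shift.
  have [H1 H2 H3] := sQ; split=> // w [s t] H; have [E sE aE] := H1 _ _ H.
  have {}H : exec c (upd (fun=> Null) 0 (enc_offline Q)) w s t := H.
  exists s, E; split=> // x nx; rewrite /= (exec_unassigned H)// /upd.
  by case: eqVneq nx => // ->; rewrite leqNgt assigned_gt0.
move=> _ [m' [E [-> cm' m'0 aE]]]; apply: triple_assign.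
exists (set_nth Null l 9 (enc_set R E)), m'; split=> //; last by exists E.
by rewrite -regs_upd//= /regs /join /= m'0.
Qed.

Lemma cost_loop_spec (es : seq (elt I)) E a d0 d1 d2 d3 d4 d5 d6 d7 d8 d9 d13 d14 d15 d16 :
  spec cost_loop [:: d0; d1; d2; d3; d4; d5; d6; d7; d8; d9; Leaf a;
      enc_list [seq Leaf (cost e) | e <- es];
      enc_list [seq of_bool R (e \in E) | e <- es]; d13; d14; d15; d16]
    (eq [:: d0; d1; d2; d3; d4; d5; d6; d7; d8; d9;
       Leaf (a + \sum_(e <- es | e \in E) cost e); Null; Null; d13; d14; d15; d16])
    (5 * size es + 1).
Proof.
elim: es a => [|e es IH] a.
  by apply: spec_while_false => //; rewrite big_nil addr0.
have -> : \sum_(e' <- e :: es | e' \in E) cost e' =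
    (if e \in E then cost e else 0) + \sum_(e' <- es | e' \in E) cost e'.
  by rewrite big_cons; case: ifP => // _; rewrite add0r.
rewrite addrA; eapply spec_le.
  eapply (spec_while_true (P := eq _)); [by []|by []| |].
  eapply (spec_seq (P := eq [:: d0; d1; d2; d3; d4; d5; d6; d7; d8; d9;
      Leaf (a + if e \in E then cost e else 0);
      enc_list [seq Leaf (cost e) | e <- e :: es];
      enc_list [seq of_bool R (e \in E) | e <- e :: es]; d13; d14; d15; d16])).
    eapply spec_if; [by []|rewrite /=|rewrite /=]; case: (e \in E) => //= _.
      by step.
    by move=> m cm; apply: triple_skip; do 2 eexists; split; rewrite ?addr0.
  move=> _ <-; step; step.
  reflexivity.
  move=> _ <-.
  exact: IH.
by rewrite /=; lia.
Qed.

Lemma solve_spec (Q : seq (request I)) b d0 d2 d3 d4 d5 d6 d7 d9 d10 d11 d12 d13 d14 d15 d16 :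
  solves Q b ->
  spec (solve c) [:: d0; enc_network I; d2; d3; d4; d5; d6; d7; enc_codes Q; d9; d10;
      d11; d12; d13; d14; d15; d16]
    (fun l => exists2 E, approx_sol gamma Q E &
       l = [:: d0; enc_network I; d2; d3; d4; d5; d6; d7; enc_codes Q; enc_set R E;
         Leaf (set_cost E); Null; Null; d13; d14; d15; d16])
    (assigned c + b + 5 * #|elt I| + 7).
Proof.
move=> sQ; eapply spec_le.
  eapply spec_seq; first exact: (call_offline_spec sQ).
  move=> _ [E aE ->] /=; step; step; step.
  eapply spec_sub; first exact: cost_loop_spec.
  move=> _ <-; exists E => //; do 11 congr cons.
  by rewrite big_enum_cond add0r /set_cost.
rewrite (_ : size _ = #|elt I|); [lia|by rewrite cardE].
Qed.

Lemma unwind_loop_spec P K d0 d1 d2 d4 d5 d7 d8 d9 d10 d11 d12 d13 d14 d15 d16 :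
  spec unwind_loop [:: d0; d1; d2; enc_pendings P; d4; d5; enc_pendings K; d7; d8; d9;
      d10; d11; d12; d13; d14; d15; d16]
    (eq [:: d0; d1; d2; enc_pendings (catrev K P); d4; d5; Null; d7; d8; d9;
      d10; d11; d12; d13; d14; d15; d16])
    (3 * size K + 1).
Proof.
elim: K P => [|p K IH] P; first exact: spec_while_false.
eapply spec_le.
  eapply (spec_while_true (P := eq _)); [by []|by []| |].
    by step; step; reflexivity.
  by move=> _ <-; exact: (IH (p :: P)).
by rewrite /=; lia.
Qed.

Lemma pop_loop_spec P snaps r x y d0 d1 d3 d4 d6 d7 d8 d9 d10 d11 d12 d13 d14 d15 d16 :
  spec pop_loop [:: d0; d1; enc_snaps P snaps; d3; d4; Pair x (Pair (Leaf r) y); d6;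
      d7; d8; d9; d10; d11; d12; d13; d14; d15; d16]
    (eq [:: d0; d1; enc_snaps P (popped r snaps); d3; d4; Pair x (Pair (Leaf r) y); d6;
      d7; d8; d9; d10; d11; d12; d13; d14; d15; d16])
    (2 * size snaps + 1).
Proof.
elim: snaps => [|[t K] snaps IH] /=; first exact: spec_while_false.
case: ifP => rt; last first.
  apply: spec_le (_ : (1 <= _)%N); last by lia.
  by apply: spec_while_false => //=; rewrite /arith /= rt.
eapply spec_le.
  eapply (spec_while_true (P := eq _)); [by []|by rewrite /= /arith /= rt| |].
    by step; reflexivity.
  by move=> _ <-; exact: IH.
by lia.
Qed.

Lemma insert_loop_spec p P K d0 d1 d2 d4 d7 d8 d9 d10 d11 d12 d13 d14 d15 d16 :
  spec insert_loop [:: d0; d1; d2; enc_pendings P; d4; enc_pending p; enc_pendings K; d7;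
      d8; d9; d10; d11; d12; d13; d14; d15; d16]
    (fun l => exists P1 P2, insert p P = P1 ++ p :: P2 /\
      l = [:: d0; d1; d2; enc_pendings P2; d4; enc_pending p;
              enc_pendings (catrev P1 K); d7;
              d8; d9; d10; d11; d12; d13; d14; d15; d16])
    (3 * size P + 1).
Proof.
elim: P K => [|p1 P IH] K /=.
  by apply: spec_while_false => //; exists [::], [::].
case: ifP => dl; last first.
  apply: spec_le (_ : (1 <= _)%N); last by lia.
  apply: spec_while_false => //=; first by rewrite /arith /= dl.
  by exists [::], (p1 :: P).
eapply spec_le.
  eapply (spec_while_true (P := eq _)); [by []|by rewrite /= /arith /= dl| |].
    by step; step; reflexivity.
  move=> _ <-; eapply spec_sub; first exact: (IH (p1 :: K)).
  by move=> _ [P1 [P2 [-> ->]]]; exists (p1 :: P1), P2.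
by lia.
Qed.

(** The contribution of [P] to the size of an offline instance, with one extra unit per list
    cell. *)
Definition weight P : nat := \sum_(p <- P) (data_size (nd_code (treq (ptr p)))).+1.

Lemma size_le_weight P : (size P <= weight P)%N.
Proof.
elim: P => [|p P IH] //=; rewrite /weight big_cons -/(weight P).
by rewrite addSn ltnS; apply: leq_trans IH (leq_addl _ _).
Qed.

Lemma weight_cons p P : weight (p :: P) = ((data_size (nd_code (treq (ptr p)))).+1 + weight P)%N.
Proof. exact: big_cons. Qed.

Lemma data_size_offline P :
  data_size (enc_offline (reqs P)) = (data_size (enc_network I) + weight P + 2)%N.
Proof.
rewrite /enc_offline /=; suff -> : data_size (enc_list [seq nd_code q | q <- reqs P]) =
  (weight P).+1 by lia.
elim: P => [|p P IH] /=; first by rewrite /weight big_nil.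
by rewrite weight_cons IH; lia.
Qed.

Definition solve_time b : nat := assigned c + b + 5 * #|elt I| + 7.

Definition scanned B Q E full P K d0 d2 d4 d5 (l : seq data) : Prop :=
  exists E' K', scan gamma B Q E full P E' K' /\
    exists x8 x9 x10 x11 x12 x14 x15 x16,
    l = [:: d0; enc_network I; d2; Null; d4; d5; enc_pendings (catrev K' K); Leaf B;
         x8; x9; x10; x11; x12; enc_set R E'; x14; x15; x16].

(** Requests taken and still to be examined together fit into size [D], so every offline call has
    expected time at most [b]. *)
Lemma scan_loop_spec D b B Q E full P K d0 d2 d4 d5 d8 d9 d10 d11 d12 d15 d16 :
  (forall Q' : seq (request I), (data_size (enc_offline Q') <= D)%N -> solves Q' b) ->
  (data_size (enc_network I) + (weight Q + weight P) + 2 <= D)%N ->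
  truthy d15 = full ->
  spec (scan_loop c) [:: d0; enc_network I; d2; enc_pendings P; d4; d5; enc_pendings K;
      Leaf B; d8; d9; d10; d11; d12; enc_set R E; enc_codes (reqs Q); d15; d16]
    (scanned B Q E full P K d0 d2 d4 d5)
    (size P * (solve_time b + 12) + 1).
Proof.
move=> sol; elim: P Q E full K d8 d9 d10 d11 d12 d15 d16 => [|p P IH]
    Q E full K d8 d9 d10 d11 d12 d15 d16 wD d15E.
  apply: spec_while_false => //=; exists E, [::]; split; first exact: scan_nil.
  by do 8 eexists.
have wP : (data_size (enc_network I) + (weight Q + weight P) + 2 <= D)%N.
  by move: wD; rewrite weight_cons; lia.
have wpP : (data_size (enc_network I) + (weight (p :: Q) + weight P) + 2 <= D)%N.
  by move: wD; rewrite !weight_cons; lia.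
rewrite /= mulSn; have [Bp|pB] := leP B (plevel p).
  eapply spec_le.
    eapply (spec_while_true (P := eq _)); [by []|by []| |].
      step; step; eapply spec_if_true; [by []|by rewrite /= /arith /= Bp|].
      by step; reflexivity.
    move=> _ <-; eapply spec_sub.
      exact: (IH Q E full (p :: K) d8 d9 d10 d11 d12 d15 _ wP d15E).
    move=> _ [E' [K' [sc [x8 [x9 [x10 [x11 [x12 [x14 [x15 [x16 ->]]]]]]]]]]].
    exists E', (p :: K'); split; first exact: scan_high.
    by do 8 eexists.
  by lia.
have pBF : (B <= plevel p) = false by rewrite leNgt pB.
move: d15E; case: full => d15E.
  eapply spec_le.
    eapply (spec_while_true (P := eq _)); [by []|by []| |].
      step; step; eapply spec_if_false; [by []|by rewrite /= /arith /= pBF|].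
      eapply spec_if_true; [by []|by []|].
      by step; reflexivity.
    move=> _ <-; eapply spec_sub.
      exact: (IH Q E true (raise B p :: K) d8 d9 d10 d11 d12 d15 _ wP d15E).
    move=> _ [E' [K' [sc [x8 [x9 [x10 [x11 [x12 [x14 [x15 [x16 ->]]]]]]]]]]].
    exists E', (raise B p :: K'); split; first exact: scan_full.
    by do 8 eexists.
  by lia.
have solp : solves (reqs (p :: Q)) b.
  by apply: sol; rewrite data_size_offline; move: wpP; lia.
eapply spec_le.
  eapply (spec_while_true (P := fun l => exists2 E1, approx_sol gamma (reqs (p :: Q)) E1 &
      l = if set_cost E1 <= B then
        [:: d0; enc_network I; d2; enc_pendings P; d4; d5; enc_pendings K;
          Leaf B; enc_codes (reqs (p :: Q)); enc_set R E1; Leaf (set_cost E1); Null; Null;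
          enc_set R E1; enc_codes (reqs (p :: Q)); d15; enc_pending p]
      else [:: d0; enc_network I; d2; enc_pendings P; d4; d5;
          enc_pendings (raise B p :: K);
          Leaf B; enc_codes (reqs (p :: Q)); enc_set R E1; Leaf (set_cost E1); Null; Null;
          enc_set R E; enc_codes (reqs Q); Leaf 1%:R; enc_pending p])); [by []|by []| |].
    step; step; eapply spec_if_false; [by []|by rewrite /= /arith /= pBF|].
    eapply spec_if_false; [by []|by rewrite /= d15E|].
    step; eapply spec_seq; first exact: (solve_spec _ _ _ _ _ _ _ _ _ _ _ _ _ _ _ solp).
    move=> _ [E1 aE1 ->]; eapply spec_if; [by []|rewrite /= /arith /=..].
      case: (leP (set_cost E1) B) => //= cE _.
      by step; step; exists E1; rewrite ?cE.
    case: (leP (set_cost E1) B) => //= cE _.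
    by step; step; exists E1; rewrite // leNgt cE.
  move=> _ [E1 aE1 ->]; case: (leP (set_cost E1) B) => cE.
    eapply spec_sub.
      exact: (IH (p :: Q) E1 false K _ _ _ _ _ d15 _ wpP d15E).
    move=> _ [E' [K' [sc [x8 [x9 [x10 [x11 [x12 [x14 [x15 [x16 ->]]]]]]]]]]].
    exists E', K'; split; first exact: scan_serve cE sc.
    by do 8 eexists.
  eapply spec_sub.
    exact: (IH Q E true (raise B p :: K) _ _ _ _ _ (Leaf 1%:R) _ wP erefl).
  move=> _ [E' [K' [sc [x8 [x9 [x10 [x11 [x12 [x14 [x15 [x16 ->]]]]]]]]]]].
  exists E', (raise B p :: K'); split; first exact: scan_stop cE sc.
  by do 8 eexists.
by rewrite /solve_time; lia.
Qed.

Lemma weight_subseq K P : subseq (map (@ptr R I) K) (map (@ptr R I) P) ->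
  (weight K <= weight P)%N.
Proof.
have wE P' : weight P' = (\sum_(q <- map (@ptr R I) P') (data_size (nd_code (treq q))).+1)%N.
  by rewrite /weight big_map.
rewrite !wE; move: (map _ K) (map _ P) => t u; elim: u t => [|q u IH] [|r t] //=.
  by rewrite big_nil.
rewrite !big_cons; case: eqP => [-> /IH|_ /IH]; first by rewrite leq_add2l.
by rewrite big_cons => /leq_trans; apply; apply: leq_addl.
Qed.

Definition service_bound D b : nat := D * (solve_time b + 15) + 20.

(** Each service removes at least the expiring request, so the number of pending requests bounds the
    iterations. *)
Lemma service_loop_spec D b P1 snaps plan N d0 d5 d6 d7 d8 d9 d10 d11 d12 d13 d14 d15 d16 :
  (forall Q' : seq (request I), (data_size (enc_offline Q') <= D)%N -> solves Q' b) ->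
  planned gamma P1 snaps plan -> (size (cur P1 snaps) <= N)%N ->
  (data_size (enc_network I) + weight P1 + 2 <= D)%N ->
  spec (service_loop c) [:: d0; enc_network I; enc_snaps P1 snaps;
      enc_pendings (cur P1 snaps); enc_schedule plan; d5; d6; d7; d8; d9; d10; d11; d12;
      d13; d14; d15; d16]
    (fun l => exists snaps' plan', [/\ planned gamma P1 snaps' plan', cur P1 snaps' = [::] &
      exists x3 x5 x6 x7 x8 x9 x10 x11 x12 x13 x14 x15 x16,
        l = [:: d0; enc_network I; enc_snaps P1 snaps'; x3; enc_schedule plan'; x5; x6; x7;
                x8; x9; x10; x11; x12; x13; x14; x15; x16]])
    (N * service_bound D b + 1).
Proof.
move=> sol pl szN wD.
elim: N snaps plan pl szN d5 d6 d7 d8 d9 d10 d11 d12 d13 d14 d15 d16 => [|N IH] snaps plan pl szN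
    d5 d6 d7 d8 d9 d10 d11 d12 d13 d14 d15 d16.
  move: szN; rewrite leqn0 size_eq0 => /eqP cP; rewrite cP.
  apply: spec_while_false => //=; exists snaps, plan; split=> //.
  by do 13 eexists.
case cP : (cur P1 snaps) szN => [|p P] szN.
  eapply spec_le.
    apply: spec_while_false => //=; exists snaps, plan; split=> //.
    by do 13 eexists.
  by lia.
have lvl2 : plevel p + plevel p = 2 * plevel p by rewrite mulr_natl mulr2n.
have wpP : (weight (p :: P) <= weight P1)%N.
  by rewrite -cP; apply: weight_subseq; apply: planned_subseq pl.
have szP : (size P <= D)%N.
  by have := size_le_weight (p :: P); rewrite /=; lia.
eapply spec_le.
  eapply (spec_while_true (P := fun l => exists E K,
      scan gamma (2 * plevel p) [:: p] (psol p) false P E K /\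
      exists x5 x6 x7 x8 x9 x10 x11 x12 x13 x14 x15 x16,
        l = [:: d0; enc_network I;
          enc_snaps P1 ((deadline (ptr p), K) :: snaps); enc_pendings K;
          enc_schedule ((deadline (ptr p), E) :: plan); x5; x6; x7;
          x8; x9; x10; x11; x12; x13; x14; x15; x16])); [by []|by []| |].
    do 7 step; rewrite lvl2; eapply spec_seq.
      apply: (@scan_loop_spec D b _ [:: p] (psol p) false P [::] _ _ _ _ _ _ _ _ _ Null) => //.
      by move: wpP wD; rewrite !weight_cons /weight big_nil; lia.
    move=> _ [E [K [sc [x8 [x9 [x10 [x11 [x12 [x14 [x15 [x16 ->]]]]]]]]]]].
    eapply (spec_seq (b1 := 3 * size P + 1)).
      eapply spec_le; first exact: (unwind_loop_spec [::]).
      have := size_subseq (scan_subseq sc).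
      by rewrite !size_map -[catrev K [::]]/(rev K) size_rev; lia.
    move=> _ <-; rewrite -[catrev K [::]]/(rev K) -[catrev _ [::]]/(rev (rev K)) revK.
    by step; step; exists E, K; split=> //; do 12 eexists.
  move=> _ [E [K [sc [x5 [x6 [x7 [x8 [x9 [x10 [x11 [x12 [x13 [x14 [x15 [x16 ->]]]]]]]]]]]]]]].
  apply: (IH ((deadline (ptr p), K) :: snaps)) => /=.
    by apply: (@planned_cons _ _ _ _ _ _ (_, _)) pl _; rewrite cP; exact: Service.
  have := size_subseq (scan_subseq sc); rewrite !size_map.
  by move: szN; rewrite /=; lia.
rewrite mulSn; suff : (size P * (solve_time b + 15) <= D * (solve_time b + 15))%N.
  by rewrite /service_bound; lia.
by rewrite leq_mul2r szP orbT.
Qed.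

(** [Null] is the state before the first call. *)
Definition enc_state (st : data) P snaps : Prop :=
  st = enc_snaps P snaps \/ [/\ st = Null, P = [::] & snaps = [::]].

Definition call_time D b : nat := solve_time b + 8 * D + D * service_bound D b + 40.

Lemma online_spec D b st P0 snaps q :
  (forall Q' : seq (request I), (data_size (enc_offline Q') <= D)%N -> solves Q' b) ->
  enc_state st P0 snaps -> (size snaps <= D)%N ->
  (data_size (enc_network I) + (data_size (nd_code (treq q)) + 
    weight (cur P0 (popped (release q) snaps))) + 3 <= D)%N ->
  spec (online c) [:: Pair (enc_network I) (Pair st (enc_timed_request q));
      Null; Null; Null; Null; Null; Null; Null; Null; Null; Null; Null; Null; Null; Null;
      Null; Null]
    (fun l => exists P1 snaps' plan, call_ok gamma P0 snaps q P1 snaps' plan /\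
       nth Null l 0 = Pair (enc_snaps P1 snaps') (enc_schedule plan))
    (call_time D b).
Proof.
move=> sol stE szs wD; set P := cur P0 _ in wD *.
have sz1 : (size P <= D)%N by have := size_le_weight P; lia.
have solq : solves [:: treq q] b.
  have wq : weight [:: Pending q 0 finset.set0] = (data_size (nd_code (treq q))).+1.
    by rewrite weight_cons /weight big_nil addn0.
  by apply: sol; rewrite (data_size_offline [:: Pending q 0 finset.set0]) wq; lia.
eapply spec_le.
  (* [d2] is either a stack of snapshots or the [Null] of the first call, from which the empty list
     is read. *)
  step; step; step; eapply (spec_seq (b1 := 2 * D + 1) (P := fun l => exists d2,
    (if d2 is Pair (Pair _ d) _ then d else Null) = enc_pendings P /\
    l = [:: Pair (enc_network I) (Pair st (enc_timed_request q)); enc_network I; d2;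
      Null; Null; enc_timed_request q; Null; Null; Null; Null; Null; Null; Null; Null; Null;
      Null; Null])).
    case: stE => [->|[-> eP es]].
      eapply spec_le.
        eapply spec_sub; first exact: (pop_loop_spec P0 snaps).
        move=> _ <-; exists (enc_snaps P0 (popped (release q) snaps)); split=> //.
        by rewrite /P /enc_snaps; case: (popped _ _).
      by lia.
    eapply spec_le; first apply: spec_while_false => //.
      by exists Null; split=> //; rewrite /P eP es.
    by lia.
  move=> _ [d2 [d2P ->]]; step.
  rewrite (_ : (if (if d2 is Pair d _ then d else Null) is Pair _ d then d else Null) =
     enc_pendings P); last by rewrite -d2P; case: (d2) => // -[].
  step; eapply spec_seq; first exact: (solve_spec _ _ _ _ _ _ _ _ _ _ _ _ _ _ _ solq).
  move=> _ [E aE ->]; step.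
  pose p := Pending q (set_cost E) E.
  eapply (spec_seq (b1 := 3 * D + 1)).
    eapply spec_le; first exact: (insert_loop_spec p P [::]).
    by lia.
  move=> _ [A [B [insE ->]]]; step; eapply (spec_seq (b1 := 3 * D + 1)).
    eapply spec_le; first exact: (unwind_loop_spec (p :: B)).
    rewrite -[catrev A [::]]/(rev A) size_rev.
    have := perm_size (perm_insert p P); rewrite insE size_cat /=; lia.
  move=> _ <-; rewrite catrevE -[catrev A [::]]/(rev A) revK -insE; step.
  eapply spec_seq.
    apply: (@service_loop_spec D b (insert p P) [::] [::] D) => //.
    - exact: planned_nil.
    - rewrite (perm_size (perm_insert _ _)) /=; have := size_le_weight P; lia.
    - rewrite /weight (perm_big _ (perm_insert p P)) -/(weight (p :: P)) weight_cons.
      by rewrite -[ptr p]/q; lia.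
  move=> _ [snaps' [plan [pl cE [x3 [x5 [x6 [x7 [x8 [x9 [x10 [x11 [x12 [x13 [x14 [x15 [x16 ->]]]]]]]]]]]]]]]].
  step; exists (insert p P), snaps', plan; split=> //.
  by exists E.
by rewrite /call_time /solve_time; lia.
Qed.

End Specs.

(** * Online runs *)

Section CompetitiveRatio.
Variables (R : realType) (I : network R) (gamma : R).
Implicit Types (s : seq (timed_request I)) (S : schedule I).

Lemma opt_deadlines_le s S : sched_feasible s S -> opt_deadlines s <= sched_cost S.
Proof.
move=> sS; apply: ge_inf; last by exists S.
by exists 0 => _ [S' _ <-]; apply: sumr_ge0 => x _; apply: set_cost_ge0.
Qed.

Lemma abstract_run_competitive s S : online_input s ->
  abstract_run gamma [::] [::] s S ->
  sched_feasible s S /\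
  sched_cost S <= 36 * gamma * (1 + ln (minn (size s) #|elt I|)%:R) * opt_deadlines s.
Proof.
move=> os rn.
have [|||||h [jh Sh sv]] := @abstract_run_ok _ _ _ s _ _ _ _ [::] [::] rn os.
- by [].
- by [].
- by case: (s).
- by [].
- by case: (s).
rewrite cats0 in jh.
have fS : sched_feasible s S by apply/allP => q /sv.
split=> //.
have S0 (S' : schedule I) : 0 <= sched_cost S'.
  by apply: sumr_ge0 => x _; apply: set_cost_ge0.
have oS := opt_deadlines_le fS.
have o0 : 0 <= opt_deadlines s.
  apply: lb_le_inf; first by exists (sched_cost S), S.
  by move=> _ [S' _ <-].
(* For [gamma <= 0] the evidence makes all budgets at most zero, so the algorithm pays nothing and
   the optimum is zero. *)
have [g0|g0] := ltP 0 gamma; last first.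
  have hS0 : \sum_(x <- h) x.1 <= 0.
    elim: h jh {Sh sv} => [|x h IH] /=; first by rewrite big_nil.
    move=> [[_ [Q [_ _ _ Qx _]]] /IH]; rewrite big_cons.
    have : gamma * set_opt Q <= 0 by rewrite mulr_le0_ge0// opt_ge0.
    lra.
  have -> : opt_deadlines s = 0 by have := S0 S; lra.
  by rewrite mulr0; lra.
set k := 36 * gamma * _.
have k0 : 0 < k.
  rewrite mulr_gt0 ?mulr_gt0// ltr_pwDl//.
  by case: (minn _ _) => [|n]; [rewrite ln0|rewrite ln_ge0// ler1n].
rewrite mulrC -ler_pdivrMr//; apply: lb_le_inf; first by exists (sched_cost S), S.
move=> _ [S' fS' <-]; rewrite ler_pdivrMr// mulrC.
exact: le_trans Sh (justified_le g0 fS' jh).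
Qed.

End CompetitiveRatio.

(** * Online runs as coin experiments *)

Section OnlineRuns.
Variables (R : realType) (I : network R).
Local Notation data := (data R).
Implicit Types (q : timed_request I) (s : seq (timed_request I))
  (S plan : schedule I) (c : cmd).

Lemma enc_list_inj : injective (@enc_list R).
Proof. by elim=> [|d l IH] [|d' l'] //= [-> /IH->]. Qed.

Lemma enc_set_inj (T : finType) : injective (@enc_set R T).
Proof.
have bool_inj : injective (of_bool R) by case=> [] [].
move=> E E' /enc_list_inj/eq_in_map h; apply/setP => e.
by apply: bool_inj; apply: h; rewrite mem_enum.
Qed.

(** [online_run] takes any plan with the returned encoding; injectivity makes it unique. *)
Lemma enc_schedule_inj : injective (@enc_schedule R I).
Proof.
move=> S S' /enc_list_inj; apply: inj_map => -[x E] [x' E'] [-> eE].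
by rewrite (enc_set_inj eE).
Qed.

Definition online_outcome c st s : seq bool -> schedule I * nat -> Prop :=
  fun w r => online_run c st s w r.1 r.2.

(* The plan is part of the result, since [join_call] has to truncate it. *)
Definition after_call c s (a : store R * nat) :
    seq bool -> schedule I * (schedule I * nat) -> Prop :=
  fun w r => exists2 st', a.1 0%N = Pair st' (enc_schedule r.1) &
    online_outcome c st' s w r.2.

Definition call_input st q : data := Pair (enc_network I) (Pair st (enc_timed_request q)).

Definition join_call q s (a : store R * nat) (r : schedule I * (schedule I * nat)) :
    schedule I * nat := (until_next q s r.1 ++ r.2.1, (a.2 + r.2.2)%N).

Lemma online_outcome_nil c st w r : online_outcome c st [::] w r <->
  w = [::] /\ r = ([::], 0%N).
Proof.
case: r => S t; split=> [H|[-> [-> ->]]]; last exact: online_done.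
by rewrite /online_outcome /= in H; inversion H.
Qed.

Lemma online_outcome_cons c st q s w r : online_outcome c st (q :: s) w r <->
  exists w1 w2 a b, [/\ w = w1 ++ w2,
    outcome c (upd (fun=> Null) 0 (call_input st q)) w1 a, after_call c s a w2 b &
    r = join_call q s a b].
Proof.
case: r => S t; split.
  rewrite /online_outcome /= => H; inversion H; subst.
  match goal with H : runs _ _ _ _ _ |- _ => case: H => s1 H1 s10 end.
  by exists w0, w', (s1, t0), (plan, (S0, t')); split=> //; exists st'.
move=> [w1 [w2 [[s1 t1] [[plan [S' t']] [-> H1 [st' /= s10 H2] [-> ->]]]]]].
apply: online_step H2; exists s1 => //; exact: H1.
Qed.

Lemma after_call_unambiguous c s a :
  (forall st, unambiguous (online_outcome c st s)) -> unambiguous (after_call c s a).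
Proof.
move=> us w u [plan r] [plan' r'] [st1 e1 H1] [st2 e2 H2].
move: e2; rewrite e1 => -[est /enc_schedule_inj eplan].
rewrite /= in eplan; rewrite -est in H2.
by have [-> /= ->] := us _ _ _ _ _ H1 H2; rewrite eplan.
Qed.

Lemma online_outcome_unambiguous c st s : unambiguous (online_outcome c st s).
Proof.
elim: s st => [|q s IH] st.
  move=> w u r r' /online_outcome_nil[-> ->] /online_outcome_nil[].
  by move=> /= -> ->.
apply: (unambiguous_bind (X := outcome c (upd (fun=> Null) 0 (call_input st q)))
  (F := after_call c s) (g := join_call q s)).
- exact: outcome_unambiguous.
- by move=> a; exact: after_call_unambiguous.
- by move=> w r /online_outcome_cons.
Qed.

End OnlineRuns.

(** * Expected running time of a sequence of calls *)

Section OnlineTermination.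
Variables (R : realType) (I : network R) (gamma : R) (c : cmd).
Implicit Types (s : seq (timed_request I)).

Lemma popped_planned_ex r (P : seq (pending I)) snaps plan : planned gamma P snaps plan ->
  exists plan', planned gamma P (popped r snaps) plan'.
Proof.
elim=> {snaps plan} [|snaps plan x B K pl IH sx] /=; first by exists [::]; left.
case: ifP => // _; exists (x :: plan); exact: planned_cons pl sx.
Qed.

(** Every planned service has removed a request, which bounds the snapshots left for [pop_loop]. *)
Lemma planned_size (P : seq (pending I)) snaps plan : planned gamma P snaps plan ->
  (size snaps + size (cur P snaps) <= size P)%N.
Proof.
elim=> {snaps plan} [|snaps plan x B K pl IH sx] //=; apply: leq_trans IH.
case: sx => p P' E K' /scan_subseq/size_subseq; rewrite !size_map /=; lia.
Qed.

Definition total_weight s : nat := \sum_(q <- s) (data_size (nd_code (treq q))).+1.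

(** The joint weight of pending and future requests never grows, so one [D] serves all calls. *)
Lemma online_terminates D b s st (P0 : seq (pending I)) snaps plan :
  (forall Q : seq (request I), (data_size (enc_offline Q) <= D)%N -> solves gamma c Q b) ->
  enc_state st P0 snaps -> planned gamma P0 snaps plan ->
  (data_size (enc_network I) + (weight P0 + total_weight s) + 2 <= D)%N ->
  terminates R (online_outcome (online c) st s) snd
    (fun r => abstract_run gamma P0 snaps s r.1) (size s * call_time I c D b).
Proof.
move=> sol; elim: s st P0 snaps plan => [|q s IH] st P0 snaps plan stE pl wD.
  apply: (@terminates_ret _ _ _ _ _ _ ([::], 0%N)) => //; last exact: abstract_nil.
  by move=> w r; exact: online_outcome_nil.
have wqs : total_weight (q :: s) = ((data_size (nd_code (treq q))).+1 + total_weight s)%N.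
  exact: big_cons.
have [plan' pl'] := popped_planned_ex (release q) pl.
have wcur : (weight (cur P0 (popped (release q) snaps)) <= weight P0)%N.
  by apply: weight_subseq; apply: planned_subseq pl'.
have callq : triple (online c) (upd (fun=> Null) 0 (call_input st q))
    (fun m => exists P1 snaps' plan', call_ok gamma P0 snaps q P1 snaps' plan' /\
       m 0%N = Pair (enc_snaps P1 snaps') (enc_schedule plan')) (call_time I c D b).
  have szs : (size snaps <= D)%N.
    by have := planned_size pl; have := size_le_weight P0; lia.
  have wD' : (data_size (enc_network I) + (data_size (nd_code (treq q)) +
      weight (cur P0 (popped (release q) snaps))) + 3 <= D)%N by move: wqs; lia.
  have := @online_spec _ I gamma c D b st P0 snaps q sol stE szs wD' (fun=> Null)
    (fun _ _ => erefl).
  rewrite (_ : regs _ _ = upd (fun=> Null) 0 (call_input st q)).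
    move/triple_sub; apply=> // _ [l [m [-> _ [P1 [snaps' [plan1 [ok l0]]]]]]].
    by exists P1, snaps', plan1.
  apply/funext => x; rewrite /regs /join /upd; case: ltnP => [|h].
    by do 17 (case: x => [//|x]).
  by rewrite gtn_eqF// (leq_trans _ h).
rewrite mulSn -[(_ + _)%N]addn0.
apply: (@terminates_bind _ _ _ _ _ (after_call (online c) s) (join_call q s)
  _ _ (fun r => r.2.2) _ _ _ _ _ _ _ _ _ _ callq).
- exact: outcome_unambiguous.
- by move=> a; apply: after_call_unambiguous => st'; exact: online_outcome_unambiguous.
- by move=> w r; exact: online_outcome_cons.
- by move=> a r; rewrite addn0.
move=> [s1 t1] [P1 [snaps' [plan1 [ok /= s10]]]].
have [E [aE eP1 pl1 _]] := ok.
rewrite -[(size s * _)%N]addn0.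
apply: (@terminates_map _ _ _ (online_outcome (online c) (enc_snaps P1 snaps') s)
  (fun r => (plan1, r)) _ snd).
- exact: online_outcome_unambiguous.
- move=> w [plan2 r]; split=> [[st' /= e H]|[r' H [-> ->]]].
    move: e; rewrite s10 => -[est /enc_schedule_inj eplan].
    by exists r; rewrite ?eplan // est.
  by exists (enc_snaps P1 snaps').
- by move=> r; rewrite addn0.
- apply: terminates_sub (IH (enc_snaps P1 snaps') P1 snaps' plan1 _ pl1 _) _ (leqnn _).
  + by left.
  + rewrite eP1 /weight (perm_big _ (perm_insert _ _)) -/(weight (_ :: _)) weight_cons.
    by set p := Pending _ _ _; rewrite -[ptr p]/q; move: wcur wD; rewrite wqs; lia.
  + by move=> [S t] /=; exact: abstract_cons.
Qed.

End OnlineTermination.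

(** * Polynomial bounds for the running time *)

Definition poly_bounded (f : nat -> nat) : Prop :=
  exists p : {poly nat}, forall x, (f x <= p.[x])%N.

Lemma poly_bounded_cst a : poly_bounded (fun=> a).
Proof. by exists a%:P => x; rewrite hornerC. Qed.

Lemma poly_bounded_id : poly_bounded id.
Proof. by exists 'X => x; rewrite hornerX. Qed.

Lemma poly_bounded_horner (p : {poly nat}) : poly_bounded (fun x => p.[x]).
Proof. by exists p. Qed.

Lemma poly_boundedD f g : poly_bounded f -> poly_bounded g ->
  poly_bounded (fun x => f x + g x)%N.
Proof.
by move=> [p fp] [q gq]; exists (p + q) => x; rewrite hornerD; apply: leq_add.
Qed.

Lemma poly_boundedM f g : poly_bounded f -> poly_bounded g ->
  poly_bounded (fun x => f x * g x)%N.
Proof.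
by move=> [p fp] [q gq]; exists (p * q) => x; rewrite hornerM; apply: leq_mul.
Qed.

(** Natural coefficients make every monomial monotone. *)
Lemma leq_horner (p : {poly nat}) x y : (x <= y)%N -> (p.[x] <= p.[y])%N.
Proof.
move=> xy; rewrite !horner_coef.
elim/big_ind2 : _ => // [a b a' b' h h'|i _]; first exact: leq_add.
apply: leq_mul => //; elim: (nat_of_ord i) => // j IH.
by rewrite !exprS; apply: leq_mul.
Qed.

Section Assembly.
Variables (R : realType) (I : network R) (gamma : R).
Implicit Types (s : seq (timed_request I)).

Lemma data_size_online s :
  (data_size (enc_network I) + total_weight s + size s + 2 <=
   data_size (enc_online s))%N.
Proof.
have -> : data_size (enc_online s) = (data_size (enc_network I) +
    data_size (enc_list [seq enc_timed_request q | q <- s])).+1 by [].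
suff : (total_weight s + size s + 1 <=
    data_size (enc_list [seq enc_timed_request q | q <- s]))%N by lia.
elim: s => [|q s IH] /=; first by rewrite /total_weight big_nil.
by rewrite /total_weight big_cons -/(total_weight s); lia.
Qed.

Lemma card_le_data_size : (#|elt I| <= data_size (enc_network I))%N.
Proof.
rewrite cardE; apply: leqW; apply: leq_trans (leq_addr _ _).
by elim: (enum _) => //= e es; lia.
Qed.

Lemma call_time_le c D b : (#|elt I| <= D)%N ->
  (call_time I c D b <= (assigned c + b + 5 * D + 50) * (D * D + D + 1) * 30)%N.
Proof.
move=> ID; set U := (_ + 50)%N; have U1 : (50 <= U)%N by rewrite /U; lia.
have stU : (solve_time I c b + 15 <= U)%N by rewrite /solve_time /U; lia.
have h1 : (D * (D * (solve_time I c b + 15)) <= D * (D * U))%N by rewrite !leq_mul.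
have h2 : (D * 1 <= D * U)%N by rewrite leq_mul//; lia.
by rewrite /call_time /service_bound; move: h1 h2; lia.
Qed.

End Assembly.

(** * From an approximation algorithm to the online algorithm *)

Section MainProof.
Variables (R : realType) (m : mode) (ND : network R -> Prop) (gamma : R) (c : cmd).
Hypothesis approx : approx_algorithm m ND gamma c.

Lemma approx_solves : exists p : {poly nat}, forall I, ND I ->
  forall (Q : seq (request I)) D, (data_size (enc_offline Q) <= D)%N ->
  solves gamma c Q p.[D].
Proof.
have [_ sol [p tp]] := approx; exists p => I NDI Q D QD.
have timeE w v : offline_time c Q w v <->
    exists2 r, outcome c (upd (fun=> Null) 0 (enc_offline Q)) w r & v = r.2%:R.
  split; first by move=> [y [t [[s' H _] ->]]]; exists (s', t).
  by move=> [[s' t] H ->]; exists (s' 0%N), t; split=> //; exists s'.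
have [t1 t2] := (expected_at_mostP _ (@outcome_unambiguous _ _ _) timeE).1 (tp I NDI Q).
split=> //; last by apply: le_trans t2 _; rewrite lee_fin ler_nat leq_horner.
move=> w [s' t] H.
have [E [e QE Ele]] : exists E : {set elt I}, [/\ s' 0%N = enc_set R E, feasible Q E &
    set_cost E <= gamma * opt Q].
  by apply: (sol I NDI Q w (s' 0%N) t); exists s'.
by exists E.
Qed.

Lemma online_correct : online_algorithm m ND
  (fun k n => 36 * gamma * (1 + ln (minn k n)%:R)) (online c).
Proof.
have [p sol] := approx_solves.
have T I (NDI : ND I) (s : seq (timed_request I)) :
    terminates R (online_outcome (online c) Null s) snd
      (fun r => abstract_run gamma [::] [::] s r.1)
      (size s * call_time I c (data_size (enc_online s)) p.[data_size (enc_online s)]).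
  apply: (online_terminates (plan := [::])) => [Q QD|||].
  - exact: sol.
  - by right.
  - exact: planned_nil.
  - by have := data_size_online s; rewrite /weight big_nil; lia.
split.
- have [+ _ _] := approx; case: (m) => //=; exact: coin_free_online.
- move=> I NDI s os w S t H; have [rn _ _] := T I NDI s.
  by have [] := abstract_run_competitive os (rn w (S, t) H).
- move=> I NDI s os; have [rn X1 _] := T I NDI s.
  apply/(expected_at_mostP (X := online_outcome (online c) Null s)
    (f := fun r => sched_cost r.1)).
  + exact: online_outcome_unambiguous.
  + move=> w v; split; first by move=> [S [t [H ->]]]; exists (S, t).
    by move=> [[S t] H ->]; exists S, t.
  split=> //; set k := _ * opt_deadlines s.
  have le r w : online_outcome (online c) Null s w r -> sched_cost r.1 <= k.
    by move=> /rn/(abstract_run_competitive os)[].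
  (* The sign of [gamma] is unknown; nonnegativity is read off from an actual outcome, whose cost
     lies between 0 and [k]. *)
  have k0 : 0 <= k.
    have [w [r /le]] := terminates_ex (T I NDI s); apply: le_trans.
    by apply: sumr_ge0 => x _; apply: set_cost_ge0.
  apply: (@le_trans _ _ (expect (online_outcome (online c) Null s) (fun=> k%:E))).
    by apply: le_expect => w r H; rewrite lee_fin; apply: le H.
  by rewrite expect_cst// X1 mule1.
have [p' p'P] : poly_bounded (fun x => x * ((assigned c + p.[x] + 5 * x + 50) *
    (x * x + x + 1) * 30))%N.
  do ?[apply: poly_boundedM|apply: poly_boundedD|apply: poly_bounded_cst|
       apply: poly_bounded_id|apply: poly_bounded_horner].
exists p' => I NDI s os; have [_ X1 Xt] := T I NDI s.
apply/(expected_at_mostP (X := online_outcome (online c) Null s)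
  (f := fun r => r.2%:R)).
- exact: online_outcome_unambiguous.
- move=> w v; split; first by move=> [S [t [H ->]]]; exists (S, t).
  by move=> [[S t] H ->]; exists S, t.
split=> //; apply: le_trans Xt _; rewrite lee_fin ler_nat.
apply: leq_trans (p'P _); have sz := data_size_online s.
apply: leq_mul; first by lia.
by apply: call_time_le; have := card_le_data_size I; lia.
Qed.

End MainProof.

Theorem theorem6p1 (R : realType) :
  exists C : R, forall (m : mode) (ND : network R -> Prop) (gamma : R),
    (exists c : cmd, approx_algorithm m ND gamma c) ->
    exists c : cmd,
      online_algorithm m ND
        (fun k n => C * gamma * (1 + ln (minn k n)%:R)) c.
Proof.
exists 36 => m ND gamma [c approx]; exists (online c).
exact: online_correct.
Qed.
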